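(* Let $P$ be a nonempty set, $X$ and $Y$ Banach spaces, $F:P\times X\rightrightarrows Y$ a set-valued mapping such that $\operatorname{gph}F_p$ is closed for all $p\in P$, $\bar x\in X$, $\bar y\in Y$, $\alpha>0$, $\delta\in]0,+\infty]$ and $\mu\in]0,+\infty]$. The mapping $F$ is $\alpha$-subregular in $x$ uniformly in $p$ over $P$ at $(\bar x,\bar y)$ with $\delta$ and $\mu$ if, for some $\eta\in]0,1[$, and all $p\in P$, $x\in B_{\delta+\mu}(\bar x)$ and $y\in Y$ satisfying $x\notin F_p^{-1}(\bar y)$ and $y\in F(p,x)\cap B_{\alpha\mu}(\bar y)$, one of the following conditions is satisfied: (i) with $D^*:=D^*_C$ (Clarke coderivative), $$d\left(0,D^*F_p(x,y)\left(\frac{v^*}{\|v^*\|}\right)\right)\ge\frac{\alpha}{1-\eta}\qquad(\ast)$$ for all $y^*\in Y^*$ satisfying $\|y^*\|=1$ and $\langle y^*,y-\bar y\rangle=\|y-\bar y\|$, and all $v^*\in B_\eta(y^* )$; (ii) $X$ and $Y$ are Asplund, and there exists a $\tau\in]0,1[$ such that inequality $(\ast)$ holds with $D^*:=D^*_F$ (Fréchet coderivative) for all $y^*\in Y^*$ satisfying $\|y^*\|=1$ and $\langle y^*,y-\bar y\rangle>\tau\|y-\bar y\|$, and all $v^*\in B_\eta(y^* )$.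
   Context: $B_r(z)$ denotes the open ball with center $z$ and radius $r\in]0,+\infty]$ (also in dual spaces). $d(z,\emptyset)=+\infty$. Products of normed spaces carry the maximum norm. For $p\in P$, $F_p:=F(p,\cdot)$, $\operatorname{gph}F_p=\{(x,y)\mid y\in F(p,x)\}$, $F_p^{-1}(y)=\{x\in X\mid y\in F(p,x)\}$. Definition. $F$ is $\alpha$-subregular in $x$ uniformly in $p$ over $P$ at $(\bar x,\bar y)$ with $\delta$ and $\mu$ if $\alpha\, d(x,F_p^{-1}(\bar y))\le d(\bar y,F(p,x))$ for all $p\in P$ and $x\in B_\delta(\bar x)$ with $d(\bar y,F(p,x))<\alpha\mu$. Fréchet normal cone to $\Omega$ at $\bar z\in\Omega$: $N^F_\Omega(\bar z)=\{z^*\mid\limsup_{\Omega\ni z\to\bar z,\,z\ne\bar z}\frac{\langle z^*,z-\bar z\rangle}{\|z-\bar z\|}\le0\}$. Clarke tangent cone $T^C_\Omega(\bar z)$: the set of $w$ such that for all sequences $z_k\to\bar z$ in $\Omega$ and $t_k\downarrow0$ there exist $w_k\to w$ with $z_k+t_kw_k\in\Omega$ for all $k$. Clarke normal cone: $N^C_\Omega(\bar z)=\{z^*\mid\langle z^*,w\rangle\le0\ \forall w\in T^C_\Omega(\bar z)\}$. Coderivatives of $\Phi:X\rightrightarrows Y$ at $(x,y)\in\operatorname{gph}\Phi$: $D^*\Phi(x,y)(y^* )=\{x^*\in X^*\mid(x^*,-y^* )\in N_{\operatorname{gph}\Phi}(x,y)\}$, with $N=N^C$ for $D^*_C$ and $N=N^F$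 for $D^*_F$. A Banach space is Asplund if the dual of each of its separable subspaces is separable.
   Formalization: For each p, a single one of (i), (ii) is required to hold for all x and y in question, and in (ii) τ may not depend on x, y; if the choice of condition or τ may vary with (x,y), the assertion is false. *)

(* Defs.v *)
From HB Require Import structures.
From mathcomp Require Import all_boot all_order all_algebra.
From mathcomp Require Import all_classical all_reals all_analysis.

Set Implicit Arguments.
Unset Strict Implicit.
Unset Printing Implicit Defensive.

Import Order.TTheory GRing.Theory Num.Theory.
Import numFieldNormedType.Exports.

Local Open Scope classical_set_scope.
Local Open Scope ring_scope.

(* The topological dual of X, as a normed space under the operator norm. *)
Section dual_space.
Context {R : realType} {X : normedModType R}.

Definition dual_pred : {pred X -> R^o} :=
  fun f => `[< linear f /\ continuous f >].

Lemma dual_pred_submod_closed : submod_closed dual_pred.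
Proof.
split.
  apply/asboolP; split; first by move=> a u v /=; rewrite /GRing.zero /= scaler0 addr0.
  exact: cst_continuous.
move=> a f g /asboolP[fl fc] /asboolP[gl gc]; apply/asboolP; split.
  move=> b u v /=; rewrite !fctE fl gl !scalerDr !scalerA (mulrC a) -!addrA.
  by congr (_ + _); rewrite addrCA.
move=> x; apply: cvgD; last exact: gc.
by apply: cvgZl_tmp; exact: fc.
Qed.

HB.instance Definition _ := GRing.isSubmodClosed.Build R (X -> R^o) dual_pred
  dual_pred_submod_closed.

End dual_space.

Record dual {R : realType} (X : normedModType R) := Dual {
  dual_val :> X -> R^o ;
  dual_valP : dual_val \in dual_pred }.

Section dual_instances.
Context {R : realType} {X : normedModType R}.

HB.instance Definition _ := [isSub for (@dual_val R X)].
HB.instance Definition _ := [Choice of dual X by <:].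
HB.instance Definition _ := [SubChoice_isSubLmodule of dual X by <:].

Lemma dual_linear (f : dual X) : linear f.
Proof. by case: f => f /= /asboolP[]. Qed.

Lemma dual_continuous (f : dual X) : continuous f.
Proof. by case: f => f /= /asboolP[]. Qed.

HB.instance Definition _ (f : dual X) :=
  GRing.isLinear.Build R X R^o *:%R (dual_val f) (dual_linear f).

Definition dual_norm (f : dual X) : R :=
  sup [set `|f x| | x in [set x | `|x| <= 1]].

Lemma dual_norm_has_sup (f : dual X) :
  has_sup [set `|f x| | x in [set x | `|x| <= 1]].
Proof.
split; first by exists `|f 0|; exists 0 => //=; rewrite normr0.
have /linear_boundedP/pinfty_ex_gt0[M M0 fM] :=
  continuous_linear_bounded 0 (@dual_continuous f 0).
exists M => _ [x /= x1 <-]; apply: le_trans (fM x) _.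
by rewrite -[leRHS]mulr1 ler_wpM2l// ltW.
Qed.

Lemma dual_norm_ub (f : dual X) x : `|x| <= 1 -> `|f x| <= dual_norm f.
Proof.
by move=> x1; apply: (ub_le_sup (dual_norm_has_sup f).2); exists x.
Qed.

Lemma dual_norm_le (f : dual X) x : `|f x| <= dual_norm f * `|x|.
Proof.
have [->|x0] := eqVneq x 0; first by rewrite linear0 !normr0 mulr0.
have nx0 : 0 < `|x| by rewrite normr_gt0.
rewrite -ler_pdivrMr// mulrC -[X in X * _]ger0_norm ?invr_ge0//.
have := @dual_norm_ub f (`|x|^-1 *: x).
rewrite linearZ/= normrM; apply.
by rewrite normrZ ger0_norm ?invr_ge0// mulVf// gt_eqF.
Qed.

Lemma dual_normD (f g : dual X) : dual_norm (f + g) <= dual_norm f + dual_norm g.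
Proof.
apply: ge_sup; first exact: (dual_norm_has_sup _).1.
move=> _ [x /= x1 <-]; apply: le_trans (ler_normD _ _) _.
by apply: lerD; exact: dual_norm_ub.
Qed.

Lemma dual_normZ_le (a : R) (f : dual X) : dual_norm (a *: f) <= `|a| * dual_norm f.
Proof.
apply: ge_sup; first exact: (dual_norm_has_sup _).1.
move=> _ [x /= x1 <-]; rewrite normrM.
by apply: ler_wpM2l => //; exact: dual_norm_ub.
Qed.

Lemma dual_normZ (a : R) (f : dual X) : dual_norm (a *: f) = `|a| * dual_norm f.
Proof.
apply/eqP; rewrite eq_le dual_normZ_le/=.
have [->|a0] := eqVneq a 0.
  rewrite normr0 mul0r; apply: le_trans (normr_ge0 _) _.
  by apply: (@dual_norm_ub _ 0); rewrite normr0.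
rewrite -ler_pdivlMl ?normr_gt0//.
have := @dual_normZ_le a^-1 (a *: f).
by rewrite scalerA mulVf// scale1r normfV.
Qed.

Lemma dual_norm_eq0 (f : dual X) : dual_norm f = 0 -> f = 0.
Proof.
move=> f0; apply/val_inj/funext => x /=.
by apply/eqP; rewrite -normr_le0; have := dual_norm_le f x; rewrite f0 mul0r.
Qed.

HB.instance Definition _ := Lmodule_isNormed.Build R (dual X)
  dual_normD dual_normZ dual_norm_eq0.

End dual_instances.

(* The pair of functionals (xs, ys) seen as an element of (X x Y)^*. *)
Section dual_pair.
Context {R : realType} {X Y : normedModType R} (xs : dual X) (ys : dual Y).

Definition dual_pair_fun (z : X * Y) : R^o := xs z.1 + ys z.2.

Lemma dual_pair_subproof : dual_pair_fun \in dual_pred.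
Proof.
apply/asboolP; split.
  move=> a u v; rewrite /dual_pair_fun /= !linearP scalerDr -!addrA.
  by congr (_ + _); rewrite addrCA.
move=> z; apply: cvgD.
  by apply: (cvg_comp _ _ cvg_fst); exact: dual_continuous.
by apply: (cvg_comp _ _ cvg_snd); exact: dual_continuous.
Qed.

Definition dual_pair : dual (X * Y)%type := Dual dual_pair_subproof.

End dual_pair.

(* A linear subspace S of X as a normed space under the induced norm. *)
Record subsp {R : realType} {X : normedModType R} (S : submodClosed X) := Subsp {
  subsp_val :> X ;
  subsp_valP : subsp_val \in S }.

Section subsp_instances.
Context {R : realType} {X : normedModType R} (S : submodClosed X).

HB.instance Definition _ := [isSub for (@subsp_val R X S)].
HB.instance Definition _ := [Choice of subsp S by <:].
HB.instance Definition _ := [SubChoice_isSubLmodule of subsp S by <:].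

Definition subsp_norm (u : subsp S) : R := `|subsp_val u|.

Lemma subsp_normD (u v : subsp S) : subsp_norm (u + v) <= subsp_norm u + subsp_norm v.
Proof. exact: ler_normD. Qed.

Lemma subsp_normZ (a : R) (u : subsp S) : subsp_norm (a *: u) = `|a| * subsp_norm u.
Proof. exact: normrZ. Qed.

Lemma subsp_norm_eq0 (u : subsp S) : subsp_norm u = 0 -> u = 0.
Proof. by move=> /normr0_eq0 u0; exact: val_inj. Qed.

HB.instance Definition _ := Lmodule_isNormed.Build R (subsp S)
  subsp_normD subsp_normZ subsp_norm_eq0.

End subsp_instances.

Definition separable (T : topologicalType) :=
  exists2 D : set T, countable D & dense D.

Definition asplund {R : realType} (X : completeNormedModType R) :=
  forall S : submodClosed X, separable (subsp S) -> separable (dual (subsp S)).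

Section normal_cones.
Context {R : realType} {Z : normedModType R} (Omega : set Z) (zbar : Z).

Definition frechet_normal : set (dual Z) :=
  [set zs | (limf_esup (fun z => (zs (z - zbar) / `|z - zbar|)%:E)
               (within Omega zbar^') <= 0)%E].

Definition clarke_tangent : set Z :=
  [set w | forall (z : nat -> Z) (t : nat -> R),
     (forall k, Omega (z k)) -> z @ \oo --> zbar ->
     (forall k, 0 < t k) -> t @ \oo --> (0 : R) ->
     exists wk : nat -> Z,
       wk @ \oo --> w /\ forall k, Omega (z k + t k *: wk k)].

Definition clarke_normal : set (dual Z) :=
  [set zs | forall w, clarke_tangent w -> zs w <= 0].

End normal_cones.

Section set_valued.
Context {R : realType} {X Y : normedModType R}.

Definition gph (Phi : X -> set Y) : set (X * Y) := [set z | Phi z.1 z.2].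

Definition preimg (Phi : X -> set Y) (y : Y) : set X := [set x | Phi x y].

Definition coderivative
    (N : set (X * Y) -> X * Y -> set (dual (X * Y)%type))
    (Phi : X -> set Y) (x : X) (y : Y) (ys : dual Y) : set (dual X) :=
  [set xs | N (gph Phi) (x, y) (dual_pair xs (- ys))].

Definition clarke_coderivative := coderivative clarke_normal.

Definition frechet_coderivative := coderivative frechet_normal.

End set_valued.

(* The open ball whose radius may be +oo. *)
Definition eball {R : realType} {Z : normedModType R} (z : Z) (r : \bar R) : set Z :=
  [set u | (`|u - z|%:E < r)%E].

Lemma edistE {R : realType} {Z : normedModType R} (x y : Z) :
  edist (x, y) = `|x - y|%:E.
Proof.
apply/eqP; rewrite eq_le; apply/andP; split.
  apply/lee_addgt0Pr => e e0; apply: ereal_inf_lbound.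
  exists (`|x - y| + e) => //=; split; first by rewrite ltr_wpDl.
  by rewrite -ball_normE /= ltrDl.
apply: le_ereal_inf_tmp => _ [r [r0 +] <-]; rewrite -ball_normE /= => xyr.
by rewrite lee_fin ltW.
Qed.

(* By edistE, edist_inf A z is the norm distance from z to A (+oo if A is empty). *)
Definition subregular {R : realType} {P : Type} {X Y : normedModType R}
    (F : P -> X -> set Y) (alpha : R) (xbar : X) (ybar : Y)
    (delta mu : \bar R) :=
  forall p x, eball xbar delta x ->
    (edist_inf (F p x) ybar < alpha%:E * mu)%E ->
    (alpha%:E * edist_inf (preimg (F p) ybar) x <= edist_inf (F p x) ybar)%E.

(* Main.v *)
Require Import Defs.
From HB Require Import structures.
From mathcomp Require Import all_boot all_order all_algebra.
From mathcomp Require Import all_classical all_reals all_analysis.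
From mathcomp Require Import ring lra.

Set Implicit Arguments.
Unset Strict Implicit.
Unset Printing Implicit Defensive.

Import Order.TTheory GRing.Theory Num.Theory.
Import numFieldNormedType.Exports.

Local Open Scope classical_set_scope.
Local Open Scope ring_scope.

(* If subregularity fails at [x0], Ekeland's principle yields a point [(xh, yh)]
   of the graph at which [|y - ybar| + a |x - xh| + w |y - yh|], with [a < alpha]
   and [w] small, is minimal over the graph, and [yh <> ybar].  A multiplier rule
   at this point produces a normal that violates the coderivative inequality.

   Clarke case: the minimized function is convex and nonnegative increments along
   the (convex) Clarke tangent cone are separated by the Mazur--Orlicz theorem.

   Frechet case: on a space with separable dual, the conjugate of a locally
   uniformly convex function on the dual ball is a Frechet smooth uniform
   approximation of the norm; together with a variational principle of
   Borwein--Preiss type this gives the fuzzy multiplier rule.  Asplund spaces are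
   reduced to this situation: by Mazur--Orlicz, the absence of a suitable Frechet
   normal is certified by finitely many points of the graph, in a way that is
   stable under small perturbations of the base point, so a separable subspace
   containing countably many such certificates admits no normal either. *)

(** * Sublinear functionals and the Hahn--Banach theorem *)

(** The form of the coderivative condition comes from the penalties at the Ekeland point. The
    multiplier of [w |y - yh|] perturbs the functional [ys] that supports [|y - ybar|], so the
    normal involves a vector [vs] near [ys] rather than [ys] itself. As |vs| > 1 - eta, normalising
    it turns |xs| < alpha into a coderivative element of norm below alpha / (1 - eta). Taking [a]
    strictly below [alpha] leaves room for the errors of a fuzzy rule, and staying closer to [x0]
    than the solution set forces [yh <> ybar]. In the Frechet case the norms are smoothed and the
    minimizer moves, so [ys] is norming only up to a factor, which is absorbed by [tau]. The
    obstacle there is that the Asplund property gives smoothness only on separable subspaces, while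
    a normal found in a subspace says nothing about points of the graph outside it. Hence the
    absence of normals, not their existence, is carried over to the subspace. *)

Section mazur_orlicz.
Context {R : realType} {V : lmodType R}.
Implicit Types (p q : V -> R) (A : set (V * R)).

Definition sublinear p :=
  (forall u v, p (u + v) <= p u + p v) /\
  (forall (t : R) u, 0 <= t -> p (t *: u) = t * p u).

Definition convex_cone A :=
  [/\ A (0, 0),
      forall a b, A a -> A b -> A (a.1 + b.1, a.2 + b.2) &
      forall (t : R) a, 0 <= t -> A a -> A (t *: a.1, t * a.2)].

Lemma sublinear0 p : sublinear p -> p 0 = 0.
Proof. by case=> _ /(_ 0 0 (lexx _)); rewrite scale0r mul0r. Qed.

Lemma sublinearN p v : sublinear p -> - p (- v) <= p v.
Proof.
by move=> sp; rewrite lerNl -subr_ge0 opprK addrC -[leLHS](sublinear0 sp) -(subrr v) sp.1.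
Qed.

(** The inequality for [t] together with its instance for [t^-1] gives equality, so for infima only
    one side of homogeneity has to be checked. *)
Lemma sublinear_pos p : (forall u v, p (u + v) <= p u + p v) -> p 0 = 0 ->
  (forall (t : R) u, 0 < t -> p (t *: u) <= t * p u) -> sublinear p.
Proof.
move=> pD p0 pZ; split=> // t u; rewrite le_eqVlt => /predU1P[<-|t0].
  by rewrite scale0r mul0r.
apply/eqP; rewrite eq_le pZ//= -ler_pdivlMl//.
have {1}-> : u = t^-1 *: (t *: u) by rewrite scalerA mulVf ?gt_eqF// scale1r.
by rewrite pZ// invr_gt0.
Qed.

(* The largest sublinear functional below [p] whose value at [v] is at most
   [c] whenever [(v, c)] lies in the cone [A]. *)
Lemma sublinear_reduce p A : sublinear p -> convex_cone A ->
  (forall a, A a -> 0 <= p (- a.1) + a.2) ->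
  exists q, [/\ sublinear q, forall v, q v <= p v & forall a, A a -> q a.1 <= a.2].
Proof.
move=> sp [A0 AD AZ] Ap.
(* Infimal convolution of [p] with the cone; the hypothesis on [A] is what bounds it below. *)
pose S w := [set p (w - a.1) + a.2 | a in A].
have Slb w : lbound (S w) (- p (- w)).
  move=> _ [a Aa <-]; have := Ap a Aa; have := sp.1 (- w) (w - a.1).
  by rewrite addrA addNr add0r => h1 h2; lra.
have hlb w : has_lbound (S w) by exists (- p (- w)).
have S0 w : S w !=set0 by exists (p (w - 0) + 0); exists (0, 0).
have infS w : has_inf (S w) by split.
have infle w a : A a -> inf (S w) <= p (w - a.1) + a.2.
  by move=> Aa; apply: ge_inf => //; exists a.
exists (fun w => inf (S w)); split.
- apply: sublinear_pos.
  + move=> u v; apply/ler_addgt0Pr => e e0.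
    have e20 : 0 < e / 2 by rewrite divr_gt0.
    have [_ [a Aa <-] ae] := inf_adherent e20 (infS u).
    have [_ [b Ab <-] be] := inf_adherent e20 (infS v).
    apply: (le_trans (infle (u + v) _ (AD _ _ Aa Ab))) => /=.
    have := sp.1 (u - a.1) (v - b.1).
    by rewrite opprD addrACA => h; lra.
  + apply/le_anti/andP; split.
      have := infle 0 _ A0; by rewrite /= subr0 addr0 sublinear0.
    by apply: lb_le_inf => //; have := Slb 0; rewrite oppr0 sublinear0// oppr0.
  + move=> t u t0; rewrite -ler_pdivrMl//; apply: lb_le_inf => // _ [a Aa <-].
    rewrite ler_pdivrMl// mulrDr -(sp.2 _ _ (ltW t0)) scalerBr.
    exact: (infle (t *: u) _ (AZ t a (ltW t0) Aa)).
- by move=> v; have := infle v _ A0; rewrite /= subr0 addr0.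
- by move=> a Aa; have := infle a.1 _ Aa; rewrite subrr sublinear0// add0r.
Qed.

(** Zorn's lemma, for the reversed pointwise order, yields a minimal sublinear functional below [p];
    a chain is bounded by its pointwise infimum. Minimality forces linearity. *)
Lemma hahn_banach p : sublinear p ->
  exists f : V -> R^o, linear f /\ forall v, f v <= p v.
Proof.
move=> sp.
pose T := {q : V -> R | sublinear q /\ forall v, q v <= p v}.
pose r (s t : T) := `[< forall v, sval t v <= sval s v >].
have [] := @Zorn T r.
- by move=> t; apply/asboolP.
- move=> a b c /asboolP ab /asboolP bc; apply/asboolP => v.
  exact: le_trans (bc v) (ab v).
- move=> [a ha] [b hb] /asboolP /= ab /asboolP /= ba; apply: eq_exist.
  by apply/funext => v; apply/eqP; rewrite eq_le ab ba.
- move=> A Atot; have [[t0 At0]|A0] := pselect (exists t, A t); last first.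
    by exists (exist _ p (conj sp (fun=> lexx _))) => s As; case: A0; exists s.
  pose S v := [set sval t v | t in A].
  have Slb v : lbound (S v) (- p (- v)).
    move=> _ [t At <-]; apply: le_trans (sublinearN _ (svalP t).1).
    by rewrite lerN2 (svalP t).2.
  have hlb v : has_lbound (S v) by exists (- p (- v)).
  have S0 v : S v !=set0 by exists (sval t0 v); exists t0.
  have infS v : has_inf (S v) by split.
  have infle v t : A t -> inf (S v) <= sval t v.
    by move=> At; apply: ge_inf => //; exists t.
  have sq : sublinear (fun v => inf (S v)).
    apply: sublinear_pos.
    + move=> u v; apply/ler_addgt0Pr => e e0.
      have e20 : 0 < e / 2 by rewrite divr_gt0.
      have [_ [a Aa <-] ae] := inf_adherent e20 (infS u).
      have [_ [b Ab <-] be] := inf_adherent e20 (infS v).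
      case: (Atot _ _ Aa Ab) => /asboolP ab.
        have := (svalP b).1.1 u v; have := infle (u + v) _ Ab; have := ab u; lra.
      have := (svalP a).1.1 u v; have := infle (u + v) _ Aa; have := ab v; lra.
    + apply/le_anti/andP; split.
        by apply: le_trans (infle 0 _ At0) _; rewrite (sublinear0 (svalP t0).1).
      by apply: lb_le_inf => // _ [t At <-]; rewrite (sublinear0 (svalP t).1).
    + move=> t u t0'; rewrite -ler_pdivrMl//; apply: lb_le_inf => // _ [a Aa <-].
      by rewrite ler_pdivrMl// -((svalP a).1.2 _ _ (ltW t0')) infle.
  have qp v : inf (S v) <= p v by apply: le_trans (infle v _ At0) ((svalP t0).2 v).
  by exists (exist _ (fun v => inf (S v)) (conj sq qp)) => s As; apply/asboolP => v /=; exact: infle.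
move=> [q [sq qp]] qmin; exists q; split => //.
(* Reducing [q] along the ray of (-v0, -q v0) cannot lower it, by minimality; hence q (- v0) <= - q
   v0, which gives superadditivity. *)
have qge v0 w : q w + q v0 <= q (w + v0).
  pose A : set (V * R) := [set a | exists2 t, 0 <= t & a = (- (t *: v0), - (t * q v0))].
  have Acone : convex_cone A.
    split; first by exists 0; rewrite ?scale0r ?mul0r ?oppr0.
      move=> _ _ [s s0 ->] [t t0 ->]; exists (s + t); rewrite ?addr_ge0//=.
      by rewrite scalerDl mulrDl !opprD.
    move=> s _ s0 [t t0 ->]; exists (s * t); rewrite ?mulr_ge0//=.
    by rewrite -scalerA scalerN mulrN mulrA.
  have [] := sublinear_reduce sq Acone.
    by move=> _ [t t0 ->] /=; rewrite opprK sq.2// subrr.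
  move=> q' [sq' q'q q'A].
  have q'p v : q' v <= p v by exact: le_trans (q'q v) (qp v).
  have [E] : exist _ q' (conj sq' q'p) = exist _ q (conj sq qp) :> T.
    by apply: qmin; apply/asboolP.
  have := q'A (- v0, - q v0); rewrite E /= => /(_ _)H.
  have {}H : q (- v0) <= - q v0 by apply: H; exists 1; rewrite ?scale1r ?mul1r.
  have := sq.1 (w + v0) (- v0); rewrite addrK; lra.
have qD u v : q (u + v) = q u + q v by apply/eqP; rewrite eq_le sq.1 qge.
have qN u : q (- u) = - q u.
  by apply/eqP; rewrite -subr_eq0 opprK -qD addNr sublinear0.
move=> t u v; rewrite qD; congr (_ + _).
have [t0|t0] := leP 0 t; first exact: sq.2.
rewrite -[t *: u]opprK -scaleNr qN sq.2 ?oppr_ge0 ?ltW//.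
by rewrite mulNr opprK.
Qed.

(** All multipliers come from here: [p] carries the norm bounds, [A] the linear inequalities to be
    satisfied. *)
Lemma mazur_orlicz p A : sublinear p -> convex_cone A ->
  (forall a, A a -> 0 <= p (- a.1) + a.2) ->
  exists f : V -> R^o, [/\ linear f, forall v, f v <= p v &
    forall a, A a -> f a.1 <= a.2].
Proof.
move=> sp cA Ap; have [q [sq qp qA]] := sublinear_reduce sp cA Ap.
have [f [lf fq]] := hahn_banach sq; exists f; split => //.
  by move=> v; exact: le_trans (fq v) (qp v).
by move=> a Aa; exact: le_trans (fq _) (qA a Aa).
Qed.

End mazur_orlicz.

Section dual_facts.
Context {R : realType} {X : normedModType R}.
Implicit Types f : dual X.

Lemma dual_norm_leM f (M : R) : 0 <= M -> (forall x, f x <= M * `|x|) -> `|f| <= M.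
Proof.
move=> M0 fM; apply: ge_sup; first exact: (dual_norm_has_sup f).1.
move=> _ [x /= x1 <-]; apply: (@le_trans _ _ (M * `|x|)).
  by rewrite ler_norml fM lerNl -linearN -normrN fM.
by rewrite -[leRHS]mulr1 ler_wpM2l.
Qed.

Lemma dual_apply_le f x : f x <= `|f| * `|x|.
Proof. exact: le_trans (ler_norm _) (dual_norm_le f x). Qed.

Lemma dual_exists (g : X -> R^o) (M : R) : linear g -> 0 <= M ->
  (forall x, g x <= M * `|x|) -> exists2 f : dual X, (forall x, f x = g x) & `|f| <= M.
Proof.
move=> lg M0 gM.
pose g' : {linear X -> R^o} := HB.pack g (GRing.isLinear.Build _ _ _ _ _ lg).
have cg : continuous g'.
  apply: bounded_linear_continuous; apply/linear_boundedP.
  near=> r; move=> x; rewrite ler_norml.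
  have Mr : M * `|x| <= r * `|x| by rewrite ler_wpM2r//; near: r; exact: nbhs_pinfty_ge.
  rewrite (le_trans (gM x) Mr) lerNl -linearN -normrN andbT.
  by rewrite (le_trans (gM _))// normrN.
have gP : (g : X -> R^o) \in dual_pred by apply/asboolP.
exists (Dual gP) => //; exact: dual_norm_leM.
Unshelve. all: by end_near. Qed.

(** The ray of (-b, -|b|) imposes f b >= |b|; domination by the norm gives the reverse. *)
Lemma norming_functional (b : X) : exists2 f : dual X, `|f| <= 1 & f b = `|b|.
Proof.
pose A : set (X * R) := [set a | exists2 t, 0 <= t & a = (- (t *: b), - (t * `|b|))].
have [] := @mazur_orlicz R X (fun x => `|x|) A.
- by split=> [u v|t u t0]; [exact: ler_normD|rewrite normrZ ger0_norm].
- split; first by exists 0; rewrite ?scale0r ?mul0r ?oppr0.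
    move=> _ _ [s s0 ->] [t t0 ->]; exists (s + t); rewrite ?addr_ge0//=.
    by rewrite scalerDl mulrDl !opprD.
  move=> s _ s0 [t t0 ->]; exists (s * t); rewrite ?mulr_ge0//=.
  by rewrite -scalerA scalerN mulrN mulrA.
- by move=> _ [t t0 ->] /=; rewrite opprK normrZ ger0_norm// subrr.
move=> g [lg g1 gA].
have [|f fg f1] := dual_exists lg ler01; first by move=> x; rewrite mul1r.
exists f => //; apply/le_anti/andP; split.
  by rewrite -[leRHS]mul1r (le_trans (dual_apply_le _ _))// ler_wpM2r.
have := gA (- b, - `|b|); rewrite /= -fg linearN lerN2; apply.
by exists 1; rewrite ?scale1r ?mul1r.
Qed.

End dual_facts.

(** * Variational principles *)

Section variational_principle.
Context {R : realType} {V : normedModType R}.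

(** A property of the set, so that the principle applies in spaces not declared complete, such as
    products of subspaces. *)
Definition complete_set (Om : set V) := forall u : nat -> V,
  (forall n, Om (u n)) -> cauchy (u @ \oo) -> exists2 l, Om l & u @ \oo --> l.

(* Borwein--Preiss scheme: the centres are chosen successively as almost
   minimizers of [f + phi 0 (c 0) + ... + phi (k-1) (c (k-1))]. *)
Lemma variational_principle (Om : set V) (f : V -> R) (phi : nat -> V -> V -> R)
    (w e : R) (c0 : V) :
  complete_set Om -> 0 < w -> 0 < e -> continuous f ->
  (forall i c z z', `|phi i c z - phi i c z'| <= w * 2^-1 ^+ i / 2 * `|z - z'|) ->
  (forall i c z, w * 2^-1 ^+ i / 4 * `|z - c| <= phi i c z) ->
  (forall i c, phi i c c <= e * 2^-1 ^+ i * 2^-1 ^+ i) ->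
  Om c0 -> (forall z, Om z -> f c0 <= f z + e) ->
  exists z1 (c : nat -> V), [/\ Om z1, `|z1 - c0| <= 24 * e / w &
    forall K z, Om z ->
      f z1 + \sum_(i < K) phi i (c i) z1 <=
      f z + \sum_(i < K) phi i (c i) z + w * 2^-1 ^+ K * `|z - z1|].
Proof.
move=> Omc w0 e0 fc phiL phig phie Om0 f0.
pose h k : R := 2^-1 ^+ k.
have hS k : h k.+1 = h k / 2 by rewrite /h exprSr.
have h0 k : 0 < h k by rewrite /h exprn_gt0// invr_gt0.
have h1 k : h k <= 1 by rewrite /h exprn_ile1// ?invr_ge0// invf_le1// ler1n.
have phi0 i c z : 0 <= phi i c z.
  apply: le_trans (phig i c z); rewrite -/(h i).
  by rewrite mulr_ge0// divr_ge0// mulr_ge0// ltW.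
(* The slack is of order 4^-k while [phi k] grows at rate 2^-k, so consecutive centres differ by
   O(2^-k). *)
pose good k (g : V -> R) := [set c | Om c /\ forall z, Om z -> f c + g c <= f z + g z + e * h k * h k].
have goodex k g : (forall z, 0 <= g z) -> exists c, good k g c.
  move=> g0; pose S := [set f z + g z | z in Om].
  have hS' : has_inf S.
    split; first by exists (f c0 + g c0); exists c0.
    by exists (f c0 - e) => _ [z Oz <-]; have := f0 z Oz; have := g0 z; lra.
  have ek : 0 < e * h k * h k by rewrite !mulr_gt0.
  have [_ [c Oc <-] cS] := inf_adherent ek hS'.
  exists c; split => // z Oz; apply: (le_trans (ltW cS)); rewrite lerD2r.
  by apply: ge_inf; [exact: hS'.2|exists z].
pose st := fix st k := if k is k'.+1 then
   let g := fun z => (st k').2 z + phi k' (st k').1 z in (xget c0 (good k'.+1 g), g)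
   else (c0, fun=> 0 : R).
pose c k := (st k).1; pose g k := (st k).2.
have gS k z : g k.+1 z = g k z + phi k (c k) z by [].
have g0 k z : 0 <= g k z.
  by elim: k z => [|k IH] z; [exact: lexx|rewrite gS; apply: addr_ge0; [exact: IH|exact: phi0]].
have gsum k z : g k z = \sum_(i < k) phi i (c i) z.
  by elim: k => [|k IH]; [rewrite big_ord0|rewrite gS big_ord_recr/= IH].
have cgood k : good k (g k) (c k).
  case: k => [|k]; last by exact: (xgetPex c0 (goodex k.+1 (g k.+1) (g0 k.+1))).
  by split => // z Oz; rewrite !addr0 !mulr1; exact: f0.
have Oc k : Om (c k) by have [] := cgood k.
(* Adding the two almost-minimality inequalities leaves at most 9/4 <= 3 units of e 4^-k. Dividing
   by the growth rate w 2^-k / 4 gives 12, and summing the geometric series gives 24. *)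
have step k : `|c k.+1 - c k| <= 12 * (e / w) * h k.
  have H1 := (cgood k).2 _ (Oc k.+1); have H2 := (cgood k.+1).2 _ (Oc k).
  rewrite !gS hS in H2.
  have H3 := phig k (c k) (c k.+1); have H4 := phie k (c k).
  rewrite -/(h k) in H3 H4.
  have E : e * (h k / 2) * (h k / 2) = e * h k * h k / 4 by field.
  have H5 : w * h k / 4 * `|c k.+1 - c k| <= 3 * (e * h k * h k).
    have : 0 < e * h k * h k by rewrite !mulr_gt0.
    by move: H1 H2 H3 H4; rewrite E; lra.
  have w4 : 0 < w * h k / 4 by rewrite divr_gt0// mulr_gt0.
  rewrite -(ler_pM2l w4) (le_trans H5)// le_eqVlt; apply/orP; left; apply/eqP.
  by field; rewrite gt_eqF.
have close n j : `|c (n + j)%N - c n| <= 24 * (e / w) * (h n - h (n + j)%N).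
  elim: j => [|j IH]; first by rewrite addn0 !subrr normr0 mulr0.
  rewrite addnS -[c _ - _](subrKA (c (n + j)%N)) (le_trans (ler_normD _ _))//.
  by have := step (n + j)%N; rewrite hS; move: IH; set a := e / w; lra.
have ew0 : 0 < e / w by rewrite divr_gt0.
have close' n m : (n <= m)%N -> `|c m - c n| <= 24 * (e / w) * h n.
  move=> /subnKC <-; apply: le_trans (close _ _) _.
  by apply: ler_wpM2l; [rewrite mulr_ge0// ltW|rewrite lerBlDr lerDl ltW].
have hcvg : h @ \oo --> 0 by apply: cvg_expr; rewrite ger0_norm ?invr_ge0// invf_lt1// ltr1n.
have hsmall r : 0 < r -> \forall n \near \oo, h n < r.
  move=> r0; have /cvgrPdist_lt/(_ r r0) := hcvg.
  by apply: filterS => n; rewrite sub0r normrN gtr0_norm.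
have [l Ol cl] : exists2 l, Om l & c @ \oo --> l.
  apply: Omc => //; apply/cauchy_ballP => r r0.
  have r48 : 0 < r / 2 / (24 * (e / w)) by rewrite !divr_gt0// mulr_gt0.
  have [N _ HN] := hsmall _ r48.
  exists ([set c n | n in [set n | (N <= n)%N]], [set c n | n in [set n | (N <= n)%N]]).
    by split; exists N => // n /= Nn; exists n.
  move=> [_ _] [[n Nn <-] [m Nm <-]]; rewrite -ball_normE/=.
  have /= := HN N (leqnn N); have H24 : 0 < 24 * (e / w) by rewrite mulr_gt0.
  rewrite (ltr_pdivlMr _ _ H24) mulrC => hN.
  have A1 := close' _ _ Nn; have A2 := close' _ _ Nm.
  rewrite -(subrKA (c N)) (le_lt_trans (ler_normD _ _))// (distrC (c N)).
  by move: hN A1 A2; lra.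
have lclose n : `|l - c n| <= 24 * (e / w) * h n.
  have : (fun m => `|c m - c n|) @ \oo --> `|l - c n|.
    by apply: cvg_norm; apply: cvgB => //; exact: cvg_cst.
  move=> /cvg_lim <- //; apply: limr_le; last first.
    by exists n => // m /= nm; exact: close'.
  by apply/cvg_ex; exists `|l - c n|; apply: cvg_norm; apply: cvgB => //; exact: cvg_cst.
have gL k z z' : `|g k z - g k z'| <= w * (1 - h k) * `|z - z'|.
  elim: k => [|k IH]; first by rewrite /h expr0 !subrr normr0 mulr0 mul0r.
  rewrite !gS opprD addrACA (le_trans (ler_normD _ _))// hS.
  have := phiL k (c k) z z'; rewrite -/(h k); move: IH.
  set d := `|z - z'|; lra.
have gmono z k m : (k <= m)%N -> g k z <= g m z.
  move=> /subnKC <-; elim: (m - k)%N => [|j IH]; first by rewrite addn0.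
  by rewrite addnS gS (le_trans IH)// lerDl.
(* The limit inherits upper bounds: compare with [c n] for large [n], using almost minimality of
   [c n], monotonicity of [g] in its index, and continuity. *)
have key z B : Om z -> (forall k, f z + g k z <= B) -> forall m, f l + g m l <= B.
  move=> Oz zB m; apply/ler_addgt0Pr => r r0.
  have r3 : 0 < r / 3 by rewrite divr_gt0.
  have fcl : f (c n) @[n --> \oo] --> f l by apply: cvg_comp cl _; exact: fc.
  have re : 0 < r / 3 / e by rewrite divr_gt0.
  have rw : 0 < r / 3 / w by rewrite divr_gt0.
  near \oo => n.
  have mn : (m <= n)%N by near: n; exists m.
  have F : `|f l - f (c n)| < r / 3 by near: n; move/cvgrPdist_lt : fcl; exact.
  have G : `|l - c n| < r / 3 / w by near: n; move/cvgrPdist_lt : cl; exact.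
  have H : h n < r / 3 / e by near: n; exact: hsmall.
  have gmn := gmono (c n) _ _ mn.
  have := (cgood n).2 z Oz; have := zB n.
  have : e * h n * h n < r / 3.
    apply: (@le_lt_trans _ _ (e * h n)); last by rewrite mulrC -ltr_pdivlMr.
    by rewrite -[leRHS]mulr1 ler_wpM2l// mulr_ge0// ltW.
  have : `|g m l - g m (c n)| <= r / 3.
    apply: (le_trans (gL _ _ _)); apply: (@le_trans _ _ (w * `|l - c n|)).
      by rewrite ler_wpM2r// -[leRHS]mulr1; apply: ler_wpM2l; [exact: ltW|rewrite lerBlDr lerDl ltW].
    by rewrite ltW// mulrC -ltr_pdivlMr.
  move: F gmn; rewrite ltr_norml ler_norml => /andP[? ?] ? /andP[? ?] ? ? ?; lra.
(* Each increment is at most (12 + 1) e 4^-k, and 13 e 2^-k = 26 e (h k - h k.+1). *)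
have gl k : g k l <= 26 * e * (1 - h k).
  elim: k => [|k IH]; first by rewrite /h expr0 subrr mulr0.
  rewrite gS hS.
  have := phiL k (c k) l (c k); have := phie k (c k); have := lclose k.
  rewrite -/(h k) => A1 A2; rewrite ler_norml => /andP[_ A3].
  have A4 : w * h k / 2 * `|l - c k| <= 12 * e * h k * h k.
    apply: (@le_trans _ _ (w * h k / 2 * (24 * (e / w) * h k))).
      by rewrite ler_pM2l// divr_gt0// mulr_gt0.
    by rewrite le_eqVlt; apply/orP; left; apply/eqP; field; rewrite gt_eqF.
  have A5 : e * h k * h k <= e * h k.
    by rewrite -[leRHS]mulr1 ler_wpM2l// mulr_ge0// ltW.
  by move: IH A2 A3 A4 A5; lra.
(* The supremum of the partial sums at [l] stands for the value of the full perturbation. *)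
pose S := range (fun k => g k l).
have hS' : has_sup S.
  split; first by exists (g 0%N l); exists 0%N.
  exists (26 * e) => _ [k _ <-]; apply: (le_trans (gl k)).
  have : 0 < e * h k by rewrite mulr_gt0.
  lra.
have gls k : g k l <= sup S by apply: ub_le_sup; [exact: hS'.2|exists k].
exists l, c; split => //; first by rewrite (le_trans (lclose 0%N))// mulr1 mulrA.
move=> K z Oz; rewrite -!gsum -/(h K).
(* Beyond [K] the perturbation is Lipschitz with constant w 2^-K; this is the error term of the
   conclusion. *)
have gz j : g (K + j)%N z - g K z <=
    g (K + j)%N l - g K l + w * (h K - h (K + j)%N) * `|z - l|.
  elim: j => [|j IH]; first by rewrite addn0 !subrr mulr0 mul0r addr0.
  rewrite addnS !gS hS.
  have := phiL (K + j)%N (c (K + j)%N) z l; rewrite -/(h _) ler_norml => /andP[_].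
  by move: IH; set d := `|z - l|; lra.
have wd : 0 <= w * h K * `|z - l| by rewrite !mulr_ge0// ltW.
have Kle := gls K.
(* After the supremum over [m], [sup S] cancels from both sides. *)
suff H m : f l + g m l <= f z + g K z + w * h K * `|z - l| + (sup S - g K l).
  have : sup S <= f z + g K z + w * h K * `|z - l| + (sup S - g K l) - f l.
    apply: ge_sup; first exact: hS'.1.
    by move=> _ [k _ <-]; have := H k; lra.
  lra.
move: m; apply: key Oz _ => k.
have [kK|/ltnW Kk] := leqP k K; first by have := gmono z _ _ kK; lra.
have := gz (k - K)%N; rewrite subnKC//.
have := gls k.
have : 0 <= w * h k * `|z - l| by rewrite !mulr_ge0// ltW.
by set d := `|z - l|; lra.
Unshelve. all: by end_near. Qed.

End variational_principle.

(** * Smooth approximation of the norm *)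

Lemma ultra_fmap (T T' : Type) (a : T -> T') (U : set_system T) :
  UltraFilter U -> UltraFilter (a @ U).
Proof.
move=> UU; apply: Build_UltraFilter => G PG UG; apply/seteqP; split => // A GA.
have [//|UC] := in_ultra_setVsetC (a @^-1` A) UU.
have GC : G (~` A) by exact: UG.
have : G set0 by rewrite -(setICr A); exact: filterI.
by move=> /filter_not_empty.
Qed.

Lemma sqr_lipschitz {R : realType} (a b r : R) : 0 <= a <= 1 -> 0 <= b <= 1 -> a - r <= b -> 0 <= r ->
  a ^+ 2 - 2 * r <= b ^+ 2.
Proof. by move=> /andP[? ?] /andP[? ?] ? ?; rewrite !expr2; nra. Qed.

(** [h] is the series of [c n * q n ^+ 2] with weights 2^-(n+1). Squaring makes midpoint convexity
    quantitative, since (a^2 + b^2)/2 - ((a + b)/2)^2 = (a - b)^2/4; lower semicontinuity passes to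
    the supremum of the partial sums. *)
Lemma weighted_squares {R : realType} (T : Type) (B : set T) (q : nat -> T -> R) :
  (forall n f, 0 <= q n f) -> (forall n f, B f -> q n f <= 1) ->
  exists (c : nat -> R) (h : T -> R), [/\ forall n, 0 < c n,
    forall f, B f -> 0 <= h f <= 1,
    forall n f g m, B f -> B g -> B m -> (forall n, q n m <= (q n f + q n g) / 2) ->
      h m + c n * (q n f - q n g) ^+ 2 / 4 <= (h f + h g) / 2 &
    forall (U : set_system nat) (g : nat -> T) f, Filter U -> (forall k, B (g k)) -> B f ->
      (forall n (r : R), 0 < r -> \forall k \near U, q n f - r <= q n (g k)) ->
      forall r : R, 0 < r -> \forall k \near U, h f - r <= h (g k)].
Proof.
move=> q0 q1.
pose c n : R := 2^-1 ^+ n / 2.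
have c0 n : 0 < c n by rewrite divr_gt0// exprn_gt0// invr_gt0.
pose S K f := \sum_(n < K) c n * q n f ^+ 2.
have SS K f : S K.+1 f = S K f + c K * q K f ^+ 2 by rewrite /S big_ord_recr.
have Sz f : S 0%N f = 0 by rewrite /S big_ord0.
have cq0 n f : 0 <= c n * q n f ^+ 2 by exact: mulr_ge0 (ltW (c0 n)) (sqr_ge0 _).
have S0 K f : 0 <= S K f by apply: sumr_ge0 => n _.
have Smono f K J : (K <= J)%N -> S K f <= S J f.
  move=> /subnKC <-; elim: (J - K)%N => [|j IH]; first by rewrite addn0.
  by rewrite addnS SS (le_trans IH)// lerDl.
have S1 K f : B f -> S K f <= 1.
  move=> f1; suff : S K f <= 1 - 2^-1 ^+ K.
    by move/le_trans; apply; rewrite lerBlDr lerDl exprn_ge0// invr_ge0.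
  elim: K => [|K IH]; first by rewrite Sz expr0 subrr.
  rewrite SS (exprSr (2^-1 : R) K).
  have : c K * q K f ^+ 2 <= c K.
    by rewrite -[leRHS]mulr1; apply: ler_wpM2l; [exact: ltW|rewrite exprn_ile1// q1].
  by move: IH; rewrite /c; move: (2^-1 ^+ K) (q K f ^+ 2) => x y; lra.
pose h f := sup (range (S^~ f)).
have hS f : B f -> has_sup (range (S^~ f)).
  move=> f1; split; first by exists (S 0%N f); exists 0%N.
  by exists 1 => _ [K _ <-]; exact: S1.
have hge f K : B f -> S K f <= h f.
  by move=> f1; apply: ub_le_sup; [exact: (hS f f1).2|exists K].
have hle f M : B f -> (forall K, S K f <= M) -> h f <= M.
  by move=> f1 fM; apply: ge_sup; [exact: (hS f f1).1|move=> _ [K _ <-]].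
have qmid2 n f g m : q n m <= (q n f + q n g) / 2 ->
    q n m ^+ 2 + (q n f - q n g) ^+ 2 / 4 <= (q n f ^+ 2 + q n g ^+ 2) / 2.
  have := q0 n m; rewrite !expr2.
  by move: (q n m) (q n f) (q n g) => x y z x0 xyz; nra.
exists c, h; split => //.
- by move=> f f1; rewrite (le_trans (S0 0%N f) (hge _ _ f1))/= hle// => K; exact: S1.
- move=> n f g m f1 g1 m1 qm; rewrite -lerBrDr; apply: hle => // K.
  have qc J : c J * q J m ^+ 2 <= c J * ((q J f ^+ 2 + q J g ^+ 2) / 2).
    rewrite ler_pM2l//; apply: le_trans (qmid2 _ _ _ _ (qm J)).
    by rewrite lerDl divr_ge0// sqr_ge0.
  have SK J : S J m <= (S J f + S J g) / 2.
    elim: J => [|J IH]; first by rewrite !Sz addr0 mul0r.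
    by rewrite !SS; have := qc J; lra.
  have SKn : S (K + n).+1 m + c n * (q n f - q n g) ^+ 2 / 4 <=
      (S (K + n).+1 f + S (K + n).+1 g) / 2.
    elim: K => [|K IH].
      rewrite add0n !SS; have := SK n.
      have : c n * (q n m ^+ 2 + (q n f - q n g) ^+ 2 / 4) <=
        c n * ((q n f ^+ 2 + q n g ^+ 2) / 2) by rewrite ler_pM2l// qmid2.
      lra.
    by rewrite addSn !(SS (K + n).+1); have := qc (K + n).+1; lra.
  have := hge f (K + n).+1 f1; have := hge g (K + n).+1 g1.
  have := Smono m K (K + n).+1 (leqW (leq_addr _ _)).
  by move: SKn; lra.
- move=> U g f PU g1 f1 lscn.
  have lscS K r : 0 < r -> \forall k \near U, S K f - r <= S K (g k).
    elim: K r => [|K IH] r r0.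
      by apply: nearW => k; rewrite !Sz lerBlDr add0r ltW.
    have r2 : 0 < r / 2 by rewrite divr_gt0.
    have r4 : 0 < r / 4 by rewrite divr_gt0.
    apply: filterS2 (IH _ r2) (lscn K _ r4) => k H1 H2.
    rewrite !SS.
    have H3 : q K f ^+ 2 - 2 * (r / 4) <= q K (g k) ^+ 2.
      by apply: sqr_lipschitz H2 _; rewrite ?q0 ?q1// ltW.
    have c1 : c K <= 1.
      have : (2^-1 : R) ^+ K <= 1 by rewrite exprn_ile1// ?invr_ge0// invf_le1// ler1n.
      by rewrite /c; move: (2^-1 ^+ K) => x; lra.
    have H4 : c K * (q K f ^+ 2 - 2 * (r / 4)) <= c K * q K (g k) ^+ 2.
      by rewrite ler_pM2l.
    have H5 : c K * (2 * (r / 4)) <= 2 * (r / 4).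
      by rewrite -[leRHS]mul1r ler_wpM2r// mulr_ge0// ltW.
    by move: H1 H4 H5; rewrite mulrBr; lra.
  move=> r r0; have r2 : 0 < r / 2 by rewrite divr_gt0.
  have [_ [K _ <-] HK] := sup_adherent r2 (hS f f1).
  apply: filterS (lscS K _ r2) => k H; have := hge (g k) K (g1 k).
  by move: HK H; rewrite -/(h f); lra.
Qed.

Section smooth_norm.
Context {R : realType} {V : normedModType R}.
Implicit Types f g : dual V.

Lemma separable_seq (T : normedModType R) : separable T ->
  exists s : nat -> T, forall x (r : R), 0 < r -> exists n, `|x - s n| < r.
Proof.
move=> [D /countable_injP[j jinj] dD].
exists (fun n => xget 0 [set x | D x /\ j x = n]) => x r r0.
have [y [xy Dy]] : (ball x r `&` D) !=set0.
  by apply: dD; [exists x; exact: ballxx|exact: ball_open].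
exists (j y); case: xgetP => [z _ [Dz jz]|/(_ y)[]//].
have -> : z = y by apply: jinj; rewrite ?inE.
by move: xy; rewrite -ball_normE.
Qed.

(* A weak* lower semicontinuous function on the dual ball that is locally
   uniformly convex: the squares of the distances to a dense sequence. *)
Lemma dual_lur : separable (dual V) -> exists h : dual V -> R,
  [/\ forall f, `|f| <= 1 -> 0 <= h f <= 1,
      forall f (r : R), `|f| <= 1 -> 0 < r -> exists2 k : R, 0 < k & forall g, `|g| <= 1 ->
        (h f + h g) / 2 - k <= h (2^-1 *: (f + g)) -> `|g - f| <= r &
      forall (U : set_system nat) (g : nat -> dual V) f, ProperFilter U ->
        (forall k, `|g k| <= 1) -> `|f| <= 1 -> (forall u, g k u @[k --> U] --> (f u : R)) ->
        forall r : R, 0 < r -> \forall k \near U, h f - r <= h (g k)].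
Proof.
move=> /separable_seq[s sd].
have [A [A0 As]] : exists A : nat -> R, (forall n, 0 < A n) /\ forall n, 1 + `|s n| <= A n.
  by exists (fun n => 1 + `|s n|); split => // n; rewrite ltr_pwDl.
have [q qE] : exists q : nat -> dual V -> R, forall n f, q n f = `|f - s n| / A n.
  by exists (fun n f => `|f - s n| / A n).
have qA n f : A n * q n f = `|f - s n| by rewrite qE mulrC divfK// gt_eqF.
have q0 n f : 0 <= q n f by rewrite qE divr_ge0// ltW.
have q1 n f : `|f| <= 1 -> q n f <= 1.
  move=> f1; rewrite qE ler_pdivrMr// mul1r (le_trans (ler_normB _ _))//.
  by apply: le_trans (As n); rewrite lerD2r.
have [c [h [c0 h01 hmid hlsc]]] := weighted_squares q0 q1.
exists h; split => //.
- move=> f r f1 r0; have r4 : 0 < r / 4 by rewrite divr_gt0.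
  have [n fn] := sd f _ r4.
  (* A gap [t] in [q n] is a gap r/4 in the distance to [s n]. As [f] is within r/4 of [s n], [g] is
     then within r/2 of it. *)
  pose t := r / (4 * A n).
  have t0 : 0 < t by rewrite divr_gt0// mulr_gt0.
  exists (c n * t ^+ 2 / 4); first by rewrite divr_gt0// mulr_gt0// exprn_gt0.
  move=> g g1.
  have m1 : `|2^-1 *: (f + g)| <= 1.
    rewrite normrZ ger0_norm ?invr_ge0// mulrC ler_pdivrMr// mul1r.
    by rewrite (le_trans (ler_normD _ _))//; lra.
  have qm k : q k (2^-1 *: (f + g)) <= (q k f + q k g) / 2.
    rewrite !qE -mulrDl mulrAC ler_pM2r ?invr_gt0//.
    have e2 : s k + s k = (2 : R) *: s k by rewrite scaler_nat mulr2n.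
    have -> : 2^-1 *: (f + g) - s k = 2^-1 *: ((f - s k) + (g - s k)).
      by rewrite addrACA -opprD [RHS]scalerBr e2 scalerA mulVf ?pnatr_eq0// scale1r.
    by rewrite normrZ ger0_norm ?invr_ge0// mulrC ler_pM2r ?invr_gt0// ler_normD.
  have := hmid n f g _ f1 g1 m1 qm.
  move: (h (2^-1 *: (f + g))) => hm Hm H.
  have /ler_normlP[B1 B2] : `|q n f - q n g| <= t.
    rewrite -ler_sqr ?nnegrE ?normr_ge0 ?(ltW t0)// real_normK ?num_real//.
    rewrite -(ler_pM2l (c0 n)).
    by lra.
  have At : A n * t = r / 4 by rewrite /t; field; rewrite gt_eqF.
  have : A n * q n g <= A n * (q n f + t) by rewrite ler_pM2l//; lra.
  rewrite mulrDr At !qA => gs.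
  rewrite -(subrKA (s n)); apply: (le_trans (ler_normD _ _)).
  rewrite (distrC (s n) f); move: fn gs; move: `|g - s n| `|f - s n| => x y; lra.
- move=> U g f PU g1 f1 gf; apply: hlsc => // n r r0.
  have Ar : 0 < A n * r / 2 by rewrite divr_gt0// mulr_gt0.
  have [_ [u /= u1 <-]] := sup_adherent Ar (dual_norm_has_sup (f - s n)).
  change (sup _) with (`|f - s n|) => fu.
  have gu : `|(g k - s n) u| @[k --> U] --> (`|(f - s n) u| : R).
    by apply: cvg_norm; apply: cvgB; [exact: gf|exact: cvg_cst].
  have /cvgrPdist_lt/(_ _ Ar) := gu; apply: filterS => k /ltr_normlP[_ H1].
  have H2 : `|(g k - s n) u| <= `|g k - s n| := @dual_norm_ub _ _ (g k - s n) u u1.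
  rewrite lerBlDr -(ler_pM2l (A0 n)) mulrDr !qA.
  move: H1 H2 fu.
  by move: `|(g k - s n) u| `|g k - s n| `|(f - s n) u| `|f - s n| => x1 x2 x3 x4; lra.
Qed.

(** A Frechet supergradient: minimality is exploited through upper estimates of increments. *)
Definition supergradient (g : V -> R) (x : V) (f : dual V) := forall r : R, 0 < r ->
  exists2 d : R, 0 < d & forall u, `|u| < d -> g (x + u) - g x <= f u + r * `|u|.

(** The clause [N v <= f v] makes the supergradient norming up to [e]. *)
Definition smooth_norm_approx (e : R) (N : V -> R) :=
  [/\ forall v, `|v| - e <= N v, forall v, N v <= `|v|,
      forall u v, `|N u - N v| <= `|u - v| &
      forall v, exists f : dual V, [/\ `|f| <= 1, N v <= f v & supergradient N v f]].

Lemma ultra_bounded_cvg (U : set_system nat) (a : nat -> R) (M : R) : UltraFilter U ->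
  (forall k, `|a k| <= M) -> exists2 l, a k @[k --> U] --> l & `|l| <= M.
Proof.
move=> UU aM; have := @segment_compact R (- M) M; rewrite compact_ultra.
move=> cM; have UM : U (a @^-1` `[- M, M]%classic).
  by apply: filterE => k /=; rewrite in_itv/= -ler_norml.
have UU' : UltraFilter (a @ U) by exact: ultra_fmap.
have [l [lM al]] := cM (a @ U) UU' UM.
by exists l => //; rewrite ler_norml; move: lM; rewrite /= in_itv.
Qed.

(* Smulian: [N] is the conjugate of a locally uniformly convex function, whose
   maximizing sequences converge in norm. *)
Lemma smooth_norm_exists (e : R) : separable (dual V) -> 0 < e ->
  exists N, smooth_norm_approx e N.
Proof.
move=> /dual_lur[h [h01 hlur hlsc]] e0.
pose S v := [set f v - e * h f | f in [set f : dual V | `|f| <= 1]].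
have fv f v : `|f| <= 1 -> f v <= `|v|.
  by move=> f1; rewrite -[leRHS]mul1r (le_trans (dual_apply_le _ _))// ler_wpM2r.
have eh f : `|f| <= 1 -> 0 <= e * h f <= e.
  move=> f1; have /andP[h0 h1] := h01 f f1.
  by rewrite mulr_ge0 ?(ltW e0)//= -[leRHS]mulr1 ler_pM2l.
have Sv v : ubound (S v) `|v|.
  by move=> _ [f /= f1 <-]; have := fv f v f1; have /andP[] := eh f f1; lra.
have n01 : `|0 : dual V| <= 1 by rewrite normr0.
have hS v : has_sup (S v).
  split; first by exists ((0 : dual V) v - e * h 0); exists 0.
  by exists `|v|.
pose N v := sup (S v).
have Nge v f : `|f| <= 1 -> f v - e * h f <= N v.
  by move=> f1; apply: ub_le_sup; [exact: (hS v).2|exists f].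
have Nle v B : (forall f, `|f| <= 1 -> f v - e * h f <= B) -> N v <= B.
  by move=> H; apply: ge_sup; [exact: (hS v).1|move=> _ [f /= f1 <-]; exact: H].
have Nlip u v : N u <= N v + `|u - v|.
  apply: Nle => f f1; have := Nge v f f1; have := fv f (u - v) f1.
  by rewrite linearB /=; lra.
exists N; split.
- move=> v; have [f f1 fE] := norming_functional v.
  by have := Nge v f f1; have /andP[] := eh f f1; rewrite fE; lra.
- by move=> v; apply: ge_sup; [exact: (hS v).1|exact: Sv].
- move=> u v; rewrite ler_distl; have := Nlip u v; have := Nlip v u.
  by rewrite (distrC v u) => ? ?; apply/andP; split; lra.
move=> v.
have /choice[g gP] (k : nat) : exists g : dual V, `|g| <= 1 /\ N v - k.+1%:R^-1 < g v - e * h g.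
  have k0 : 0 < k.+1%:R^-1 :> R by rewrite invr_gt0.
  by have [_ [g /= g1 <-] gk] := sup_adherent k0 (hS v); exists g.
(* An ultrafilter finer than [\oo] provides a weak-star limit of the maximizing sequence. *)
have [U [UU ooU]] := @ultraFilterLemma nat \oo _.
have /choice[F FP] u : exists l : R, g k u @[k --> U] --> l /\ `|l| <= `|u|.
  have [|l lU l1] := @ultra_bounded_cvg U (fun k => g k u) `|u| UU; last by exists l.
  by move=> k; rewrite (le_trans (dual_norm_le _ _))// ler_piMl//; have [] := gP k.
have lF : linear (F : V -> R^o).
  move=> a x y; have [H1 _] := FP (a *: x + y).
  have [H2 _] := FP x; have [H3 _] := FP y.
  have H4 : g k (a *: x + y) @[k --> U] --> (a * F x + F y : R).
    under eq_fun do rewrite linearP; apply: cvgD => //; exact: cvgZl_tmp.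
  exact: (cvg_unique _ H1 H4).
have [|f fF f1] := dual_exists lF ler01.
  by move=> x; rewrite mul1r (le_trans (ler_norm _)); have [] := FP x.
have gf u : g k u @[k --> U] --> (f u : R) by rewrite fF; have [] := FP u.
(* Lower semicontinuity of [h] makes the limit a maximizer. *)
have Nf : N v <= f v - e * h f.
  apply/ler_addgt0Pr => r r0.
  have r3 : 0 < r / 3 by rewrite divr_gt0.
  have re : 0 < r / 3 / e by rewrite divr_gt0.
  have gv : \forall k \near U, `|f v - g k v| < r / 3.
    by have /cvgrPdist_lt/(_ _ r3) := gf v.
  near U => k.
  have H1 : h f - r / 3 / e <= h (g k).
    by near: k; apply: hlsc => // i; have [] := gP i.
  have H2 : `|f v - g k v| < r / 3 by near: k; exact: gv.
  have H3 : k.+1%:R^-1 < r / 3.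
    near: k; apply: ooU; near=> k; rewrite invf_plt ?posrE//.
    near: k; exists (Num.truncn (r / 3)^-1) => // k /= kt.
    by apply: (lt_le_trans (truncnS_gt _)); rewrite ler_nat.
  have [_ H4] := gP k.
  have H5 : e * (h f - r / 3 / e) <= e * h (g k) by rewrite ler_pM2l.
  move: H5; rewrite mulrBr [e * (_ / e)]mulrC divfK ?gt_eqF// => H5.
  move: H2 H3 H4 H5 => /ltr_normlP[A1 A2].
  move: A1 A2; move: (k.+1%:R^-1) (f v) (g k v) (e * h f) (e * h (g k)) (N v) => x1 x2 x3 x4 x5 x6.  lra.
(* The midpoint of [f] and an almost maximizer has value at most [N v], so local uniform convexity
   of [h] brings the two together in norm. *)
have strong r : 0 < r -> exists2 k, 0 < k & forall g', `|g'| <= 1 ->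
    N v - k <= g' v - e * h g' -> `|g' - f| <= r.
  move=> r0; have [k k0 Hk] := hlur f r f1 r0.
  exists (2 * e * k); first by rewrite !mulr_gt0.
  move=> g' g1 H; apply: Hk => //.
  have m1 : `|2^-1 *: (f + g')| <= 1.
    rewrite normrZ ger0_norm ?invr_ge0// mulrC ler_pdivrMr// mul1r.
    by rewrite (le_trans (ler_normD _ _))//; lra.
  have := Nge v _ m1.
  have -> : (2^-1 *: (f + g')) v = 2^-1 * (f v + g' v) by [].
  rewrite -[in X in _ -> X](ler_pM2l e0); move: Nf H.
  move: (N v) (f v) (g' v) (h f) (h g') (h _) => x1 x2 x3 x4 x5 x6; lra.
exists f; split => //.
  by have := Nf; have /andP[] := eh f f1; lra.
move=> r r0; have r2 : 0 < r / 2 by rewrite divr_gt0.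
have [k k0 Hk] := strong _ r2.
(* A functional maximal at [v + u] up to r/2 |u| is maximal at [v] up to (2 + r/2) |u|, which stays
   below [k]. *)
exists (k / (2 + r)); first by rewrite divr_gt0// addr_gt0.
move=> u; rewrite ltr_pdivlMr ?addr_gt0// => uk.
have [->|u0] := eqVneq u 0.
  by rewrite addr0 subrr linear0 normr0 mulr0 addr0.
have nu : 0 < `|u| by rewrite normr_gt0.
have ru : 0 < r / 2 * `|u| by rewrite mulr_gt0.
have [_ [g' /= g1 <-]] := sup_adherent ru (hS (v + u)).
rewrite -/(N _) linearD /= => H.
have gu := fv g' u g1.
have Nv := Nlip v (v + u).
have vu : `|v - (v + u)| = `|u| by rewrite opprD addrA subrr add0r normrN.
rewrite vu in Nv.
have := Hk g' g1; have -> : N v - k <= g' v - e * h g' by move: H gu Nv uk; lra.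
move=> /(_ isT) gf'.
have : (g' - f) u <= r / 2 * `|u|.
  by apply: (le_trans (dual_apply_le _ _)); rewrite ler_pM2r.
have -> : (g' - f) u = g' u - f u by [].
by have := Nge v g' g1; move: H; lra.
Unshelve. all: by end_near. Qed.

End smooth_norm.

(** * The Ekeland point and the Clarke case *)

Lemma prod_normE {R : realType} {X Y : normedModType R} (z : X * Y) :
  `|z| = Num.max `|z.1| `|z.2|.
Proof. by []. Qed.

Section complete_sets.
Context {R : realType}.

Lemma cauchy_nonexpansive (Z V : normedModType R) (f : Z -> V) (u : nat -> Z) :
  (forall x y, `|f x - f y| <= `|x - y|) -> cauchy (u @ \oo) -> cauchy ((f \o u) @ \oo).
Proof.
move=> f1 /cauchy_ballP uc; apply/cauchy_ballP => e e0.
have [[A B] [/= [a _ aA] [b _ bB]] AB] := uc e e0.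
exists ([set f z | z in A], [set f z | z in B]).
  split; first by exists a => // n /= an; exists (u n) => //; exact: aA.
  by exists b => // n /= bn; exists (u n) => //; exact: bB.
move=> [_ _] [/= [x Ax <-] [y By <-]]; have := AB (x, y) (conj Ax By).
by rewrite -!ball_normE/=; exact: le_lt_trans.
Qed.

(** Serves with identities for the Ekeland point and with embeddings of closed subspaces for the
    separable reduction. *)
Lemma complete_set_isometry (V W : normedModType R) (X Y : completeNormedModType R)
    (i : V -> X) (j : W -> Y) (Om : set (X * Y)) :
  (forall u v, `|i u - i v| = `|u - v|) -> (forall u v, `|j u - j v| = `|u - v|) ->
  closed (range i) -> closed (range j) -> closed Om ->
  complete_set [set z : V * W | Om (i z.1, j z.2)].
Proof.
move=> iI jI ci cj cOm u Ou uc.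
have /cauchy_cvgP/cvg_ex[l ul] : cauchy ((fun n => i (u n).1) @ \oo).
  apply: (@cauchy_nonexpansive _ _ (fun z => i z.1)) uc => x y.
  by rewrite iI prod_normE le_max lexx.
have /cauchy_cvgP/cvg_ex[m um] : cauchy ((fun n => j (u n).2) @ \oo).
  apply: (@cauchy_nonexpansive _ _ (fun z => j z.2)) uc => x y.
  by rewrite jI prod_normE le_max lexx orbT.
have [v _ vl] : range i l.
  by apply: closed_cvg ul => //; apply: nearW => n; exists (u n).1.
have [w _ wm] : range j m.
  by apply: closed_cvg um => //; apply: nearW => n; exists (u n).2.
exists (v, w).
  rewrite /= vl wm; apply: (@closed_cvg _ _ \oo _ (fun n => (i (u n).1, j (u n).2))) => //.
    by apply: nearW => n; exact: Ou.
  exact: cvg_pair.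
have H1 : (u n).1 @[n --> \oo] --> v.
  apply/cvgrPdist_lt => e e0; move/cvgrPdist_lt : ul => /(_ e e0).
  by apply: filterS => n; rewrite -vl iI.
have H2 : (u n).2 @[n --> \oo] --> w.
  apply/cvgrPdist_lt => e e0; move/cvgrPdist_lt : um => /(_ e e0).
  by apply: filterS => n; rewrite -wm jI.
rewrite (_ : u = fun n => ((u n).1, (u n).2)); first exact: cvg_pair.
by apply/funext => n; case: (u n).
Qed.

End complete_sets.

Lemma lipschitz_continuous {R : realType} {V : normedModType R} (f : V -> R) (L : R) :
  (forall x y, `|f x - f y| <= L * `|x - y|) -> continuous f.
Proof.
move=> fL x; apply/cvgrPdist_lt => e e0.
have L1 : 0 < `|L| + 1 by rewrite ltr_wpDl.
have d0 : 0 < e / (`|L| + 1) by rewrite divr_gt0.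
have := nbhsx_ballx x _ d0; apply: filterS => y.
rewrite -ball_normE /= => xy; apply: le_lt_trans (fL x y) _.
apply: (@le_lt_trans _ _ ((`|L| + 1) * `|x - y|)); last by rewrite mulrC -ltr_pdivlMr.
by apply: ler_wpM2r => //; rewrite (le_trans (ler_norm _))// lerDl.
Qed.

Section ekeland.
Context {R : realType} {X Y : completeNormedModType R}.

(** With |y0 - ybar| / r < a < alpha, a point where |y - ybar| + a |x - x0| is below a r lies within
    [r] of [x0]. The perturbation adds a slope [w'] that keeps the total below [alpha]. *)
Lemma ekeland_point (Om : set (X * Y)) (x0 : X) (y0 ybar : Y) (alpha r w : R) :
  closed Om -> Om (x0, y0) -> 0 < alpha -> 0 < r -> 0 < w -> `|y0 - ybar| < alpha * r ->
  exists xh yh (a : R), [/\ Om (xh, yh), `|xh - x0| < r /\ `|yh - ybar| < alpha * r,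
    0 <= a < alpha & forall x y, Om (x, y) ->
      `|yh - ybar| <= `|y - ybar| + a * `|x - xh| + w * `|y - yh|].
Proof.
move=> cOm Om0 al0 r0 w0 y0r.
have yr : `|y0 - ybar| / r < alpha by rewrite ltr_pdivrMr.
have yr0 : 0 <= `|y0 - ybar| / r by rewrite divr_ge0// ltW.
have [a [a1 a2]] : exists a, `|y0 - ybar| / r < a /\ a < alpha.
  by exists ((`|y0 - ybar| / r + alpha) / 2); split; lra.
have a0 : 0 < a by lra.
have ar : `|y0 - ybar| < a * r by rewrite -ltr_pdivrMr.
pose f (z : X * Y) : R := `|z.2 - ybar| + a * `|z.1 - x0|.
pose w' := Num.min w ((alpha - a) / 2).
have w'0 : 0 < w' by rewrite lt_min w0 divr_gt0// subr_gt0.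
have w'w : w' <= w by rewrite ge_min lexx.
have w'a : w' <= (alpha - a) / 2 by rewrite ge_min lexx orbT.
pose gap := a * r - `|y0 - ybar|.
have gap0 : 0 < gap by rewrite subr_gt0.
(* Chosen so that the Lipschitz constant 1 + a times the displacement 24 e / w' equals 24/25 of
   [gap]. *)
pose e := w' * gap / (25 * (1 + a)).
have e0 : 0 < e by rewrite divr_gt0// mulr_gt0// addr_gt0.
have fL z z' : `|f z - f z'| <= (1 + a) * `|z - z'|.
  have H1 : `|z.2 - z'.2| <= `|z - z'| by rewrite prod_normE le_max lexx orbT.
  have H2 : `|z.1 - z'.1| <= `|z - z'| by rewrite prod_normE le_max lexx.
  have := ler_dist_dist (z.2 - ybar) (z'.2 - ybar).
  rewrite opprB addrA subrK ler_norml => /andP[A1 A2].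
  have := ler_dist_dist (z.1 - x0) (z'.1 - x0).
  rewrite opprB addrA subrK => B1.
  have : `|a * (`|z.1 - x0| - `|z'.1 - x0|)| <= a * `|z - z'|.
    by rewrite normrM gtr0_norm// ler_pM2l// (le_trans B1).
  rewrite mulrBr ler_norml => /andP[C1 C2].
  by rewrite /f ler_norml; apply/andP; split; lra.
(* The starting point must also not exceed the value at (x0, y0): if that point is not itself
   [e]-minimal, a point within [e] of the infimum lies below it. *)
have [c0 [Oc0 c0min c0le]] : exists c0, [/\ Om c0, forall z, Om z -> f c0 <= f z + e &
    f c0 <= `|y0 - ybar|].
  have fz0 : f (x0, y0) = `|y0 - ybar| by rewrite /f/= subrr normr0 mulr0 addr0.
  have [H|/existsNP[c /not_implyP[Oc /negP]]] :=
      pselect (forall z, Om z -> f (x0, y0) <= f z + e).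
    by exists (x0, y0); split => //; rewrite fz0.
  rewrite -ltNge => cf.
  have hS : has_inf [set f z | z in Om].
    split; first by exists (f (x0, y0)); exists (x0, y0).
    by exists 0 => _ [z _ <-]; rewrite addr_ge0// mulr_ge0// ltW.
  have [_ [c1 Oc1 <-] H1] := inf_adherent e0 hS.
  exists c1; split => //.
    move=> z Oz; apply: (le_trans (ltW H1)); rewrite lerD2r.
    by apply: ge_inf; [exact: hS.2|exists z].
  rewrite -fz0 (le_trans (ltW H1))// (le_trans _ (ltW cf))// lerD2r.
  by apply: ge_inf; [exact: hS.2|exists c].
pose phi (i : nat) (c z : X * Y) : R := w' * 2^-1 ^+ i / 2 * `|z - c|.
have hi i : 0 < w' * 2^-1 ^+ i :> R by rewrite mulr_gt0// exprn_gt0// invr_gt0.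
have [||||||| z1 [c [Oz1 z1c0 zmin]]] :=
    @variational_principle R _ Om f phi w' e c0 _ w'0 e0.
- have := @complete_set_isometry _ X Y _ _ id id Om.
  rewrite (_ : [set z | _] = Om); last by apply/seteqP; split => -[].
  apply => //; by rewrite image_id; exact: closedT.
- exact: lipschitz_continuous fL.
- move=> i c z z'; rewrite /phi -mulrBr normrM gtr0_norm ?divr_gt0//.
  rewrite ler_pM2l ?divr_gt0//; apply: le_trans (ler_dist_dist _ _) _.
  by rewrite opprB addrA subrK.
- move=> i c z; rewrite /phi ler_wpM2r// ler_pM2l//.
  by rewrite lef_pV2 ?posrE// ler_nat.
- move=> i c; rewrite /phi subrr normr0 mulr0.
  have hi0 : 0 <= 2^-1 ^+ i :> R by rewrite exprn_ge0// invr_ge0.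
  by apply: mulr_ge0 => //; apply: mulr_ge0 => //; exact: ltW.
- exact: Oc0.
- exact: c0min.
have e24 : (1 + a) * (24 * e / w') < gap.
  rewrite /e.
  have -> : (1 + a) * (24 * (w' * gap / (25 * (1 + a))) / w') = 24 / 25 * gap.
    by field; rewrite !gt_eqF// addr_gt0.
  by lra.
have fz1 : f z1 < a * r.
  have := fL z1 c0; rewrite ler_norml => /andP[_ H1].
  have : (1 + a) * `|z1 - c0| <= (1 + a) * (24 * e / w') by rewrite ler_pM2l// addr_gt0.
  by move: e24; rewrite /gap; lra.
have ar' : a * r <= alpha * r by rewrite ler_pM2r// ltW.
exists z1.1, z1.2, (a + w'); split.
- by case: (z1) Oz1.
- split; last by rewrite (lt_le_trans _ ar')// (le_lt_trans _ fz1)// lerDl mulr_ge0// ltW.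
  by rewrite -(ltr_pM2l a0) (le_lt_trans _ fz1)// lerDr.
- by apply/andP; split; lra.
(* At [K = 0] the sums are empty and the principle is Ekeland's. *)
move=> x y Oxy; have := zmin 0%N (x, y) Oxy; rewrite !big_ord0 !addr0 expr0 mulr1.
have H1 : `|(x, y) - z1| <= `|x - z1.1| + `|y - z1.2|.
  by rewrite prod_normE ge_max/= lerDl lerDr !normr_ge0.
have H2 : w' * `|(x, y) - z1| <= w' * `|x - z1.1| + w' * `|y - z1.2|.
  by rewrite -mulrDr ler_pM2l.
have H3 : a * `|x - x0| <= a * `|x - z1.1| + a * `|z1.1 - x0|.
  by rewrite -mulrDr ler_pM2l// -{1}(subrKA z1.1) ler_normD.
have H4 : w' * `|y - z1.2| <= w * `|y - z1.2| by rewrite ler_wpM2r.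
by rewrite /f/=; lra.
Qed.

End ekeland.

(** * Solvability of the system defining the multipliers *)

Section feasibility.
Context {R : realType} {X Y : normedModType R}.

Definition convex_cone2 (K : X -> Y -> R -> Prop) :=
  [/\ K 0 0 0,
      forall u v c u' v' c', K u v c -> K u' v' c' -> K (u + u') (v + v') (c + c') &
      forall (t : R) u v c, 0 <= t -> K u v c -> K (t *: u) (t *: v) (t * c)].

(** Functionals dominated by [p] on X x Y x Y split into triples with the stated norm bounds; the
    second copy of Y separates the multipliers of |y - ybar| and w |y - yh|. In [A], [t = 0] encodes
    the constraints from [K], and [t = 1] with zero [K]-part encodes [beta <= ys b]. *)
Lemma functionals_exist (K : X -> Y -> R -> Prop) (a w beta : R) (b : Y) :
  convex_cone2 K -> 0 <= a -> 0 <= w ->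
  (forall u v c t, K u v c -> 0 <= t ->
    0 <= a * `|u| + `|v + t *: b| + w * `|v| + c - t * beta) ->
  exists (xs : dual X) (ys ws : dual Y), [/\ `|xs| <= a, `|ys| <= 1, `|ws| <= w,
    beta <= ys b & forall u v c, K u v c -> xs u - (ys v + ws v) <= c].
Proof.
move=> [K0 KD KZ] a0 w0 Kp.
pose p (z : X * Y * Y) : R := a * `|z.1.1| + `|z.1.2| + w * `|z.2|.
pose A : set ((X * Y * Y) * R) := [set e | exists u v c t,
  [/\ K u v c, 0 <= t & e = ((u, - v - t *: b, - v), c - t * beta)]].
have [] := @mazur_orlicz R _ p A.
- split=> [[[u1 u2] u3] [[v1 v2] v3]|t [[u1 u2] u3] t0]; rewrite /p/=.
    have := ler_normD u2 v2.
    have : a * `|u1 + v1| <= a * `|u1| + a * `|v1| by rewrite -mulrDr ler_wpM2l// ler_normD.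
    have : w * `|u3 + v3| <= w * `|u3| + w * `|v3| by rewrite -mulrDr ler_wpM2l// ler_normD.
    by lra.
  by rewrite !normrZ ger0_norm//; ring.
- split.
  + exists 0, 0, 0, 0; split => //.
    by rewrite !oppr0 !scale0r !mul0r subr0 oppr0 addr0.
  + move=> _ _ [u [v [c [t [K1 t0 ->]]]]] [u' [v' [c' [t' [K1' t0' ->]]]]] /=.
    exists (u + u'), (v + v'), (c + c'), (t + t'); split; [exact: KD|exact: addr_ge0|].
    congr ((_, _, _), _); last by ring.
      by rewrite scalerDl !opprD addrACA.
    by rewrite opprD.
  + move=> s _ s0 [u [v [c [t [K1 t0 ->]]]]] /=.
    exists (s *: u), (s *: v), (s * c), (s * t); split; [exact: KZ|exact: mulr_ge0|].
    congr ((_, _, _), _); last by ring.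
      by rewrite scalerBr scalerN scalerA.
    by rewrite scalerN.
- move=> _ [u [v [c [t [K1 t0 ->]]]]]; rewrite /p/= !opprD !opprK !normrN.
  by have := Kp _ _ _ _ K1 t0; rewrite /=; lra.
move=> f [lf fp fA].
have f0 : f 0 = 0.
  have := lf 1 0 0; rewrite !scale1r addr0 => /eqP.
  by rewrite -subr_eq0 opprD addNKr oppr_eq0 => /eqP.
have fD u v : f (u + v) = f u + f v by have := lf 1 u v; rewrite !scale1r.
have fZ t u : f (t *: u) = t * f u by have := lf t u 0; rewrite f0 !addr0.
have fN u : f (- u) = - f u by rewrite -scaleN1r fZ mulN1r.
have [||xs xsE xs1] := @dual_exists R X (fun u => f (u, 0, 0)) a _ a0.
- move=> t u v /=; rewrite -lf; congr (f _).
  by rewrite -[RHS]/(t *: u + v, t *: 0 + 0, t *: 0 + 0) !scaler0 !addr0.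
- by move=> u; apply: (le_trans (fp _)); rewrite /p/= !normr0 mulr0 !addr0.
have [||ys ysE ys1] := @dual_exists R Y (fun u => f (0, u, 0)) 1 _ ler01.
- move=> t u v /=; rewrite -lf; congr (f _).
  by rewrite -[RHS]/(t *: 0 + 0, t *: u + v, t *: 0 + 0) !scaler0 !addr0.
- by move=> u; apply: (le_trans (fp _)); rewrite /p/= !normr0 !mulr0 addr0 add0r mul1r.
have [||ws wsE ws1] := @dual_exists R Y (fun u => f (0, 0, u)) w _ w0.
- move=> t u v /=; rewrite -lf; congr (f _).
  by rewrite -[RHS]/(t *: 0 + 0, t *: 0 + 0, t *: u + v) !scaler0 !addr0.
- by move=> u; apply: (le_trans (fp _)); rewrite /p/= !normr0 !mulr0 !add0r.
have fE u v v' : f (u, v, v') = xs u + ys v + ws v'.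
  rewrite xsE ysE wsE -!fD; congr (f _).
  by rewrite -[RHS]/(u + 0 + 0, 0 + v + 0, 0 + 0 + v') !addr0 !add0r.
exists xs, ys, ws; split => //.
- have := fA ((0, - b, 0), - beta); rewrite /= fE !linear0 add0r addr0 linearN lerN2; apply.
  by exists 0, 0, 0, 1; split => //; rewrite !scale1r mul1r oppr0 !add0r.
- move=> u v c Kc; have := fA ((u, - v, - v), c); rewrite /= fE !linearN => H.
  rewrite opprD addrA; apply: H; exists u, v, c, 0; split => //.
  by rewrite scale0r mul0r !subr0.
Qed.

End feasibility.

Section clarke.
Context {R : realType} {X Y : normedModType R}.

Lemma clarke_tangent0 (Z : normedModType R) (Om : set Z) (z : Z) : clarke_tangent Om z 0.
Proof.
move=> zk t Ozk _ _ _; exists (fun=> 0); split; first exact: cvg_cst.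
by move=> k; rewrite scaler0 addr0.
Qed.

(** The points corrected along [u] form another sequence in [Om] tending to [z], so tangency of [v]
    can be applied from them. *)
Lemma clarke_tangentD (Z : normedModType R) (Om : set Z) (z u v : Z) :
  clarke_tangent Om z u -> clarke_tangent Om z v -> clarke_tangent Om z (u + v).
Proof.
move=> Tu Tv zk t Ozk zkz t0 tk0.
have [uk [uku Ouk]] := Tu zk t Ozk zkz t0 tk0.
have [|vk [vkv Ovk]] := Tv (fun k => zk k + t k *: uk k) t Ouk _ t0 tk0.
  rewrite -[z in _ --> z]addr0 -(scale0r u); apply: cvgD => //; exact: cvgZ.
exists (uk \+ vk); split; first exact: cvgD.
by move=> k /=; rewrite scalerDr addrA.
Qed.

Lemma clarke_tangentZ (Z : normedModType R) (Om : set Z) (z u : Z) (s : R) :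
  0 <= s -> clarke_tangent Om z u -> clarke_tangent Om z (s *: u).
Proof.
rewrite le_eqVlt => /predU1P[<- _|s0 Tu]; first by rewrite scale0r; exact: clarke_tangent0.
move=> zk t Ozk zkz t0 tk0.
have [| |uk [uku Ouk]] := Tu zk (fun k => t k * s) Ozk zkz.
- by move=> k; rewrite mulr_gt0.
- by rewrite -(mul0r s); apply: cvgM => //; exact: cvg_cst.
exists (fun k => s *: uk k); split; first exact: cvgZl_tmp.
by move=> k; rewrite scalerA.
Qed.

Lemma clarke_normal_exists (Om : set (X * Y)) (xh : X) (yh ybar : Y) (a w : R) :
  Om (xh, yh) -> 0 <= a -> 0 <= w ->
  (forall x y, Om (x, y) -> `|yh - ybar| <= `|y - ybar| + a * `|x - xh| + w * `|y - yh|) ->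
  exists (xs : dual X) (ys ws : dual Y), [/\ `|xs| <= a, `|ys| <= 1, `|ws| <= w,
    ys (yh - ybar) = `|yh - ybar| &
    clarke_normal Om (xh, yh) (dual_pair xs (- (ys + ws)))].
Proof.
move=> Oh a0 w0 Omin; set b := yh - ybar.
pose K u v c := clarke_tangent Om (xh, yh) (u, v) /\ c = 0 :> R.
have key u v : clarke_tangent Om (xh, yh) (u, v) -> `|b| <= `|b + v| + a * `|u| + w * `|v|.
  move=> Tuv.
  have [||||wk [wkw Owk]] := Tuv (fun=> (xh, yh)) (@harmonic R).
  - by [].
  - exact: cvg_cst.
  - by move=> k; exact: harmonic_gt0.
  - exact: cvg_harmonic.
  have c1 : (wk k).1 @[k --> \oo] --> u by exact: (cvg_comp _ _ wkw cvg_fst).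
  have c2 : (wk k).2 @[k --> \oo] --> v by exact: (cvg_comp _ _ wkw cvg_snd).
  have cv : `|b + (wk k).2| + a * `|(wk k).1| + w * `|(wk k).2| @[k --> \oo] -->
      (`|b + v| + a * `|u| + w * `|v| : R).
    have n1 : a * `|(wk k).1| @[k --> \oo] --> a * `|u| := cvgMl_tmp (cvg_norm c1).
    have n2 : w * `|(wk k).2| @[k --> \oo] --> w * `|v| := cvgMl_tmp (cvg_norm c2).
    have n3 : `|b + (wk k).2| @[k --> \oo] --> `|b + v| := cvg_norm (cvgD (cvg_cst b) c2).
    apply: cvgD; last exact: n2.
    apply: cvgD; last exact: n1.
    exact: n3.
  rewrite -(cvg_lim _ cv)//; apply: limr_ge; first by apply/cvg_ex; eexists; exact: cv.
  apply: nearW => k; have := Owk k; set t := harmonic k.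
  have t0 : 0 < t := harmonic_gt0 k.
  have t1 : t <= 1 by rewrite /t /harmonic/= invf_le1// ler1n.
  move: (wk k) => [uk vk].
  rewrite -[(xh, yh) + t *: (uk, vk)]/(xh + t *: uk, yh + t *: vk) => /Omin.
  have addBK (Z : zmodType) (x y : Z) : x + y - x = y by rewrite addrC addKr.
  rewrite !addBK (addrAC yh) !normrZ gtr0_norm// -/b => H.
  (* Convexity and t <= 1 carry the inequality from step [t] to step one, so directional derivatives
     are avoided. *)
  have H1 : `|b + t *: vk| <= (1 - t) * `|b| + t * `|b + vk|.
    have -> : b + t *: vk = (1 - t) *: b + t *: (b + vk).
      by rewrite scalerBl scale1r (scalerDr t b vk) addrA subrK.
    by rewrite (le_trans (ler_normD _ _))// !normrZ (gtr0_norm t0) ger0_norm// subr_ge0.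
  rewrite -(ler_pM2l t0) /=; move: H H1.
  by move: `|b + t *: vk| `|b + vk| `|b| `|uk| `|vk| => x1 x2 x3 x4 x5; lra.
have [||xs [ys [ws [xs1 ys1 ws1 ysb HK]]]] :=
    @functionals_exist R X Y K a w `|b| b _ a0 w0.
- split; first by split => //; exact: clarke_tangent0.
    move=> u v c u' v' c' [T1 ->] [T2 ->]; split; last by rewrite addr0.
    exact: (clarke_tangentD T1 T2).
  move=> t u v c t0 [T1 ->]; split; last by rewrite mulr0.
  exact: (clarke_tangentZ t0 T1).
- move=> u v c t [T1 ->]; rewrite le_eqVlt => /predU1P[<-|t0].
    by rewrite mul0r subr0 addr0 !addr_ge0// mulr_ge0.
  have ti : 0 <= t^-1 by rewrite invr_ge0 ltW.
  have := key _ _ (clarke_tangentZ ti T1); rewrite -(ler_pM2l t0) !mulrDr.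
  rewrite !normrZ (ger0_norm ti) [t * (a * _)]mulrCA [t * (w * _)]mulrCA !(mulrA t) mulfV ?gt_eqF// !mul1r.
  have -> : t * `|b + t^-1 *: v| = `|v + t *: b|.
    rewrite -{1}(gtr0_norm t0) -normrZ (scalerDr t b) scalerA mulfV ?gt_eqF// scale1r.
    by rewrite addrC.
  by lra.
exists xs, ys, ws; split => //.
- apply/le_anti; rewrite ysb andbT (le_trans (dual_apply_le _ _))// ler_piMl//.
- move=> [u v] Tuv; have := HK u v 0 (conj Tuv erefl).
  by rewrite /= /dual_pair_fun/=.
Qed.

End clarke.

(** * The Frechet case *)

Section supergradients.
Context {R : realType} {V : normedModType R}.
Implicit Types (g : V -> R) (x u : V) (f : dual V).

Lemma supergradientD g g' x f f' : supergradient g x f -> supergradient g' x f' ->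
  supergradient (fun z => g z + g' z) x (f + f').
Proof.
move=> gf gf' r r0; have r2 : 0 < r / 2 by rewrite divr_gt0.
have [d d0 H] := gf _ r2; have [d' d0' H'] := gf' _ r2.
exists (Num.min d d'); first by rewrite lt_min d0.
move=> u; rewrite lt_min => /andP[ud ud'].
have -> : (f + f') u = f u + f' u by [].
by have := H u ud; have := H' u ud'; lra.
Qed.

Lemma supergradientZ g x f (k : R) : 0 <= k -> supergradient g x f ->
  supergradient (fun z => k * g z) x (k *: f).
Proof.
move=> k0 gf r r0.
have k1 : 0 < k + 1 by rewrite ltr_wpDl.
have rk : 0 < r / (k + 1) by rewrite divr_gt0.
have [d d0 H] := gf _ rk; exists d => // u ud.
have -> : (k *: f) u = k * f u by [].
rewrite -mulrBr; apply: (le_trans (ler_wpM2l k0 (H u ud))).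
rewrite mulrDr lerD2l mulrA ler_wpM2r// mulrA ler_pdivrMr// mulrC.
by rewrite ler_pM2l// lerDl.
Qed.

Lemma supergradient_shift g x c f : supergradient g (x - c) f ->
  supergradient (fun z => g (z - c)) x f.
Proof.
move=> gf r r0; have [d d0 H] := gf r r0; exists d => // u ud.
by rewrite addrAC; exact: H.
Qed.

(** The geometric bound lets one late partial sum replace every earlier one at small cost. *)
Lemma supergradient_series g x f (N : nat -> V -> R) (c : nat -> V) (kap : R) :
  0 <= kap -> supergradient g x f ->
  (forall i, exists p : dual V, `|p| <= 1 /\ supergradient (N i) (x - c i) p) ->
  exists F : nat -> dual V, [/\ F 0%N = f,
    forall K, supergradient
      (fun z => g z + \sum_(i < K) kap * 2^-1 ^+ i * N i (z - c i)) x (F K) &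
    forall K L, (K <= L)%N -> `|F L - F K| <= 2 * kap * 2^-1 ^+ K].
Proof.
move=> kap0 gf /choice[p pP].
have p1 i : `|p i| <= 1 by have [] := pP i.
have pN i : supergradient (N i) (x - c i) (p i) by have [] := pP i.
have h0 i : 0 <= 2^-1 ^+ i :> R by rewrite exprn_ge0// invr_ge0.
have k0 i : 0 <= kap * 2^-1 ^+ i by rewrite mulr_ge0.
have [F [F0 FS]] : exists F : nat -> dual V, F 0%N = f /\
    forall K, F K.+1 = F K + (kap * 2^-1 ^+ K) *: p K.
  exists (fix F K := if K is K'.+1 then F K' + (kap * 2^-1 ^+ K') *: p K' else f).
  by split.
exists F; split => //.
- elim=> [|K IH].
    by rewrite F0; under eq_fun do rewrite big_ord0 addr0.
  under eq_fun do rewrite big_ord_recr /= addrA.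
  rewrite FS.
  exact: (supergradientD IH (supergradientZ (k0 K) (supergradient_shift (pN K)))).
move=> K L /subnKC <-.
suff : `|F (K + (L - K))%N - F K| <= 2 * kap * (2^-1 ^+ K - 2^-1 ^+ (K + (L - K))).
  move/le_trans; apply; apply: ler_wpM2l; first exact: mulr_ge0.
  by rewrite lerBlDr lerDl.
elim: (L - K)%N => [|j IH]; first by rewrite addn0 !subrr normr0 mulr0.
rewrite addnS FS addrAC (le_trans (ler_normD _ _))// (exprS (2^-1 : R) (K + j)).
have : `|(kap * 2^-1 ^+ (K + j)) *: p (K + j)%N| <= kap * 2^-1 ^+ (K + j).
  by rewrite normrZ ger0_norm// ler_piMr.
move: IH; move: (2^-1 ^+ K) (2^-1 ^+ (K + j)) => x3 x4.
by move: `|_ *: _| `|F _ - _| => x1 x2; lra.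
Qed.

End supergradients.

(** * The fuzzy multiplier rule under separable duals *)

Section smooth_fuzzy_rule.
Context {R : realType} {V W : normedModType R}.

(* The smooth case of the fuzzy sum rule.  The functionals, but not the radii
   [del n], may depend on the finite range [n <= M] of accuracies, so that no
   infinite series of functionals has to be summed. *)
Lemma smooth_fuzzy_rule (Om : set (V * W)) (xh : V) (yh ybar : W) (a w eps rho : R) :
  complete_set Om -> separable (dual V) -> separable (dual W) ->
  Om (xh, yh) -> yh <> ybar -> 0 <= a -> 0 <= w -> 0 < eps -> 0 < rho ->
  (forall x y, Om (x, y) -> `|yh - ybar| <= `|y - ybar| + a * `|x - xh| + w * `|y - yh|) ->
  exists x1 y1 (del : nat -> R), [/\ Om (x1, y1), `|x1 - xh| < rho /\ `|y1 - yh| < rho,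
    forall n, 0 < del n & forall M, exists (xs : dual V) (ys ws : dual W),
    [/\ `|xs| <= a + eps, `|ys| <= 1, `|ws| <= w + eps,
        (1 - eps) * `|y1 - ybar| <= ys (y1 - ybar) &
        forall n x y, (n <= M)%N -> Om (x, y) -> `|x - x1| < del n -> `|y - y1| < del n ->
          xs (x - x1) - (ys (y - y1) + ws (y - y1)) <=
          n.+1%:R^-1 * (`|x - x1| + `|y - y1|)]].
Proof.
move=> Omc sV sW Oh yhb a0 w0 eps0 rho0 Omin.
set b := `|yh - ybar|.
have b0 : 0 < b by rewrite normr_gt0 subr_eq0; apply/eqP.
(* Makes the displacement 24 e / eps smaller than [rho] and b/2; the latter keeps |y1 - ybar| >=
   b/2. *)
pose e := eps * (Num.min rho (b / 2)) / 25.
have m0 : 0 < Num.min rho (b / 2) by rewrite lt_min rho0 divr_gt0.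
have e0 : 0 < e by rewrite divr_gt0// mulr_gt0.
have aw : 0 < 1 + a + w by lra.
(* The first bound keeps (xh, yh) [e]-minimal after smoothing; the second makes [ys] norming up to
   the factor 1 - eps. *)
pose e1 := Num.min (e / (1 + a + w)) (eps * (b / 2)).
have e10 : 0 < e1 by rewrite lt_min divr_gt0//= mulr_gt0// divr_gt0.
have e1e : (1 + a + w) * e1 <= e by rewrite mulrC -ler_pdivlMr// ge_min lexx.
have e1b : e1 <= eps * (b / 2) by rewrite ge_min lexx orbT.
have [S [Sge Sle Slip Sgrad]] := smooth_norm_exists sV e10.
have [T [Tge Tle Tlip Tgrad]] := smooth_norm_exists sW e10.
pose h i : R := 2^-1 ^+ i.
have h0 i : 0 < h i by rewrite exprn_gt0// invr_gt0.
have he i : 0 < 2 * e * h i / eps by rewrite divr_gt0// !mulr_gt0.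
have /choice[N1 N1P] i := smooth_norm_exists sV (he i).
have /choice[N2 N2P] i := smooth_norm_exists sW (he i).
pose f (z : V * W) : R := (T (z.2 - ybar) + w * T (z.2 - yh)) + a * S (z.1 - xh).
(* The added constant offsets both smoothing errors, so the bracket dominates the sum of the
   coordinate norms. *)
pose phi i (c z : V * W) : R := eps / 4 * h i *
  (N1 i (z.1 - c.1) + N2 i (z.2 - c.2) + 4 * e * h i / eps).
have n1 (z : V * W) : `|z.1| <= `|z| by rewrite prod_normE le_max lexx.
have n2 (z : V * W) : `|z.2| <= `|z| by rewrite prod_normE le_max lexx orbT.
have n12 (z : V * W) : `|z| <= `|z.1| + `|z.2|.
  by rewrite prod_normE ge_max/= lerDl lerDr !normr_ge0.
have k0 i : 0 < eps / 4 * h i by rewrite mulr_gt0// divr_gt0.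
have lip1 (Z : normedModType R) (g : Z -> R) (c z z' : Z) :
    (forall u v, `|g u - g v| <= `|u - v|) -> `|g (z - c) - g (z' - c)| <= `|z - z'|.
  by move=> gl; rewrite (le_trans (gl _ _))// opprB addrA subrK.
have [||||||z1 [c [Oz1 z1h zmin]]] :=
    @variational_principle R _ Om f phi eps e (xh, yh) Omc eps0 e0.
- apply: (@lipschitz_continuous _ _ _ (1 + w + a)) => z z'.
  have := lip1 _ T ybar z.2 z'.2 Tlip; have := lip1 _ T yh z.2 z'.2 Tlip.
  have := lip1 _ S xh z.1 z'.1 Slip.
  have := n1 (z - z'); have := n2 (z - z').
  rewrite -[(z - z').1]/(z.1 - z'.1) -[(z - z').2]/(z.2 - z'.2) /f.
  move: `|z.1 - _| `|z.2 - _| `|z - z'| (T (z.2 - ybar)) (T (z'.2 - ybar)).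
  move: (T (z.2 - yh)) (T (z'.2 - yh)) (S (z.1 - xh)) (S (z'.1 - xh)).
  move=> t3 t4 s1 s2 d1 d2 d t1 t2 d2d d1d; rewrite !ler_norml.
  move=> /andP[A1 A2] /andP[B1 B2] /andP[C1 C2].
  have a1 : a * (s1 - s2) <= a * d by rewrite ler_wpM2l//; lra.
  have a2 : a * (s2 - s1) <= a * d by rewrite ler_wpM2l//; lra.
  have w1 : w * (t3 - t4) <= w * d by rewrite ler_wpM2l//; lra.
  have w2 : w * (t4 - t3) <= w * d by rewrite ler_wpM2l//; lra.
  by apply/andP; split; lra.
- move=> i c z z'; have [_ _ l1 _] := N1P i; have [_ _ l2 _] := N2P i.
  have := lip1 _ (N1 i) c.1 z.1 z'.1 l1; have := lip1 _ (N2 i) c.2 z.2 z'.2 l2.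
  have := n1 (z - z'); have := n2 (z - z').
  rewrite -[(z - z').1]/(z.1 - z'.1) -[(z - z').2]/(z.2 - z'.2) /phi -mulrBr.
  rewrite normrM gtr0_norm//; rewrite -/(h i).
  have -> : eps * h i / 2 * `|z - z'| = eps / 4 * h i * (2 * `|z - z'|) by field.
  rewrite ler_pM2l//.
  move: `|z.1 - _| `|z.2 - _| `|z - z'| (N1 _ _) (N1 _ _) (N2 _ _) (N2 _ _) (_ / eps).
  move=> d1 d2 d t1 t2 t3 t4 s d2d d1d; rewrite !ler_norml.
  by move=> /andP[A1 A2] /andP[B1 B2]; apply/andP; split; lra.
- move=> i c z; have [l1 _ _ _] := N1P i; have [l2 _ _ _] := N2P i.
  have := l1 (z.1 - c.1); have := l2 (z.2 - c.2); have := n12 (z - c).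
  rewrite -[(z - c).1]/(z.1 - c.1) -[(z - c).2]/(z.2 - c.2) /phi.
  have -> : eps * 2^-1 ^+ i / 4 * `|z - c| = eps / 4 * h i * `|z - c|.
    by rewrite -/(h i); field.
  rewrite ler_pM2l//.
  have -> : 4 * e * h i / eps = 2 * e * h i / eps + 2 * e * h i / eps by field; rewrite gt_eqF.
  move: `|z.1 - _| `|z.2 - _| `|z - c| (N1 _ _) (N2 _ _) (_ / eps).
  by move=> d1 d2 d t1 t2 s; lra.
- move=> i c; have [_ l1 _ _] := N1P i; have [_ l2 _ _] := N2P i.
  have := l1 0; have := l2 0; rewrite !normr0 /phi !subrr -/(h i) => B1 B2.
  have -> : e * h i * h i = eps / 4 * h i * (4 * e * h i / eps) by field; rewrite gt_eqF.
  rewrite ler_pM2l//; move: B1 B2; move: (N1 _ _) (N2 _ _) (_ / eps) => t1 t2 s; lra.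
- exact: Oh.
- move=> [x y] Oxy; have := Omin x y Oxy; rewrite /f/= -/b !subrr.
  have := Tle 0; have := Sle 0; rewrite !normr0 => S0 T0.
  have := Tle (yh - ybar); rewrite -/b => Tb.
  have := Tge (y - ybar).
  have : w * (`|y - yh| - e1) <= w * T (y - yh) by rewrite ler_wpM2l.
  have : a * (`|x - xh| - e1) <= a * S (x - xh) by rewrite ler_wpM2l.
  have : w * T 0 <= 0 by rewrite mulr_ge0_le0.
  have : a * S 0 <= 0 by rewrite mulr_ge0_le0.
  by move: e1e; lra.
have z1b : `|z1 - (xh, yh)| < Num.min rho (b / 2).
  apply: (le_lt_trans z1h); rewrite /e.
  have -> : 24 * (eps * Num.min rho (b / 2) / 25) / eps = 24 / 25 * Num.min rho (b / 2).
    by field; rewrite gt_eqF.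
  by move: m0; lra.
case: z1 => [x1 y1] in Oz1 z1h zmin z1b *.
have x1h : `|x1 - xh| < Num.min rho (b / 2) by apply: le_lt_trans z1b; exact: (n1 ((x1, y1) - (xh, yh))).
have y1h : `|y1 - yh| < Num.min rho (b / 2) by apply: le_lt_trans z1b; exact: (n2 ((x1, y1) - (xh, yh))).
move: x1h y1h; rewrite !lt_min => /andP[x1h _] /andP[y1h y1b].
have y1n : b / 2 <= `|y1 - ybar|.
  have : b <= `|yh - y1| + `|y1 - ybar| by rewrite /b -{1}(subrKA y1) ler_normD.
  by rewrite distrC; move: y1b; lra.
have [ys [ys1 ysT ysg]] := Tgrad (y1 - ybar).
have [t [t1 _ tg]] := Tgrad (y1 - yh).
have [s [s1 _ sg]] := Sgrad (x1 - xh).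
have eps4 : 0 <= eps / 4 by rewrite divr_ge0// ltW.
have [|F [F0 Fg Fc]] := @supergradient_series _ _ _ _ _ N1 (fun i => (c i).1) (eps / 4) eps4
    (supergradientZ a0 (supergradient_shift sg)).
  by move=> i; have [_ _ _ /(_ (x1 - (c i).1))[p [p1 _ pg]]] := N1P i; exists p.
have [|G [G0 Gg Gc]] := @supergradient_series _ _ _ _ _ N2 (fun i => (c i).2) (eps / 4) eps4
    (supergradientD (supergradient_shift ysg) (supergradientZ w0 (supergradient_shift tg))).
  by move=> i; have [_ _ _ /(_ (y1 - (c i).2))[p [p1 _ pg]]] := N2P i; exists p.
have est K (r : R) : 0 < r -> exists2 d : R, 0 < d & forall x y, Om (x, y) ->
    `|x - x1| < d -> `|y - y1| < d ->
    - F K (x - x1) - G K (y - y1) <= (r + eps * h K) * (`|x - x1| + `|y - y1|).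
  move=> r0; have [d d0 H] := Fg K r r0; have [d' d0' H'] := Gg K r r0.
  exists (Num.min d d'); first by rewrite lt_min d0.
  move=> x y Oxy; rewrite !lt_min => /andP[xd _] /andP[_ yd].
  have := zmin K (x, y) Oxy; have := H _ xd; have := H' _ yd.
  rewrite [x1 + _]addrC [y1 + _]addrC !subrK.
  have E (z : V * W) : \sum_(i < K) phi i (c i) z =
      \sum_(i < K) eps / 4 * h i * N1 i (z.1 - (c i).1) +
      \sum_(i < K) eps / 4 * h i * N2 i (z.2 - (c i).2) +
      \sum_(i < K) eps / 4 * h i * (4 * e * h i / eps).
    by rewrite -!big_split; apply: eq_bigr => i _; rewrite /phi /= !mulrDr.
  rewrite !E /f/= -/(h K).
  have : eps * h K * `|(x, y) - (x1, y1)| <= eps * h K * (`|x - x1| + `|y - y1|).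
    by rewrite ler_pM2l ?mulr_gt0//; exact: (n12 ((x, y) - (x1, y1))).
  rewrite /h.
  move: (\sum_(_ < K) _) (\sum_(_ < K) _) (\sum_(_ < K) _) (\sum_(_ < K) _) (\sum_(_ < K) _).
  move: (2^-1 ^+ K) (F K _) (G K _) `|x - x1| `|y - y1| (T _) (T _) (T _) (T _) (S _) (S _) `|_ - _|.
  by clear; move=> *; lra.
(* Accuracy (n+1)^-1 is split into thirds: the supergradient error, the remainder [eps * h K], and
   the later exchange of functionals. *)
have K_ex n : exists K, eps * h K <= (3 * n.+1%:R)^-1.
  have q0 : 0 < (3 * n.+1%:R)^-1 / eps :> R by rewrite divr_gt0// invr_gt0 mulr_gt0.
  have : h @ \oo --> 0 by apply: cvg_expr; rewrite ger0_norm ?invr_ge0// invf_lt1// ltr1n.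
  move=> /cvgrPdist_lt/(_ _ q0)[K _ /(_ K (leqnn K))]; rewrite /= sub0r normrN gtr0_norm//.
  by move=> hK; exists K; rewrite ltW// mulrC -ltr_pdivlMr.
have {K_ex} /choice[Kn KnP] := K_ex.
have q0 n : 0 < (3 * n.+1%:R)^-1 :> R by rewrite invr_gt0 mulr_gt0.
have /choice[del delP] n : exists d : R, 0 < d /\ forall x y, Om (x, y) ->
    `|x - x1| < d -> `|y - y1| < d -> - F (Kn n) (x - x1) - G (Kn n) (y - y1) <=
      ((3 * n.+1%:R)^-1 + eps * h (Kn n)) * (`|x - x1| + `|y - y1|).
  by have [d d0 H] := est (Kn n) _ (q0 n); exists d.
exists x1, y1, del; split => //.
  by move=> n; have [] := delP n.
(* One index beyond all [Kn n], n <= M, gives functionals valid for all these accuracies; replacing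
   [F (Kn n)] and [G (Kn n)] costs eps/2 h (Kn n). *)
move=> M; pose K := (\max_(n < M.+1) Kn n)%N.
have KK n : (n <= M)%N -> (Kn n <= K)%N.
  by move=> nM; exact: (@leq_bigmax _ (fun n : 'I_M.+1 => Kn n) (Ordinal (nM : (n < M.+1)%N))).
have F01 : `|F K - a *: s| <= eps / 2.
  by rewrite -F0 (le_trans (Fc 0%N K (leq0n _)))// expr0; clear; lra.
have G01 : `|G K - (ys + w *: t)| <= eps / 2.
  by rewrite -G0 (le_trans (Gc 0%N K (leq0n _)))// expr0; clear; lra.
(* [G K] contains the gradient [ys] of the smoothed |y - ybar|; what remains is within eps/2 of
   [w *: t]. *)
exists (- F K), ys, (G K - ys); split => //.
- rewrite normrN -(subrK (a *: s) (F K)) (le_trans (ler_normD _ _))// addrC.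
  apply: lerD; last by apply: (le_trans F01); move: eps0; clear; lra.
  by rewrite normrZ ger0_norm// ler_piMr.
- have -> : G K - ys = (G K - (ys + w *: t)) + w *: t by rewrite opprD addrA subrK.
  rewrite (le_trans (ler_normD _ _))// addrC.
  apply: lerD; last by apply: (le_trans G01); move: eps0; clear; lra.
  by rewrite normrZ ger0_norm// ler_piMr.
- have := Tge (y1 - ybar).
  have : eps * (b / 2) <= eps * `|y1 - ybar| by rewrite ler_pM2l.
  by move: e1b ysT; clear; lra.
move=> n x y nM Oxy xd yd.
have [_ /(_ x y Oxy xd yd) H] := delP n.
have HF : `|(F K - F (Kn n)) (x - x1)| <= eps / 2 * h (Kn n) * `|x - x1|.
  rewrite (le_trans (dual_norm_le _ _))// ler_wpM2r//.
  by apply: (le_trans (Fc _ _ (KK n nM))); rewrite -/(h _) ler_pM2r//; clear; lra.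
have HG : `|(G K - G (Kn n)) (y - y1)| <= eps / 2 * h (Kn n) * `|y - y1|.
  rewrite (le_trans (dual_norm_le _ _))// ler_wpM2r//.
  by apply: (le_trans (Gc _ _ (KK n nM))); rewrite -/(h _) ler_pM2r//; clear; lra.
move: HF HG; rewrite !ler_norml.
rewrite -[(F K - F (Kn n)) _]/(F K (x - x1) - F (Kn n) (x - x1)).
rewrite -[(G K - G (Kn n)) _]/(G K (y - y1) - G (Kn n) (y - y1)).
move=> /andP[A1 A2] /andP[B1 B2].
have Kd : eps * h (Kn n) * (`|x - x1| + `|y - y1|) <= (3 * n.+1%:R)^-1 * (`|x - x1| + `|y - y1|).
  by rewrite ler_wpM2r// addr_ge0.
have nd : n.+1%:R^-1 * (`|x - x1| + `|y - y1|) = 3 * ((3 * n.+1%:R)^-1 * (`|x - x1| + `|y - y1|)).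
  have : n.+1%:R != 0 :> R by rewrite pnatr_eq0.
  by move: (n.+1%:R) => N N0; field.
have qd : 0 <= (3 * n.+1%:R)^-1 * (`|x - x1| + `|y - y1|) by rewrite mulr_ge0 ?(ltW (q0 n))// addr_ge0.
rewrite nd -[(- F K) _]/(- F K (x - x1)) -[(G K - ys) _]/(G K (y - y1) - ys (y - y1)).
move: H Kd qd A1 A2 B1 B2; move: (3 * _)^-1 (h _) `|x - x1| `|y - y1|.
move: (F K _) (F (Kn n) _) (G K _) (G (Kn n) _) (ys _).
by clear; move=> *; lra.
Qed.

End smooth_fuzzy_rule.

(** * Frechet normals and certificates of their absence *)

Lemma frechet_normalP {R : realType} {Z : normedModType R} (Om : set Z) (z : Z) (zs : dual Z) :
  frechet_normal Om z zs <->
  forall e : R, 0 < e -> exists2 d : R, 0 < d & forall z', Om z' -> `|z' - z| < d ->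
     zs (z' - z) <= e * `|z' - z|.
Proof.
split=> [nz e e0|H].
  have /ereal_inf_lt[y [A An AE] Ae] := le_lt_trans nz (e0 : (0 < e%:E)%E).
  have /nbhs_ballP[d /= d0 dA] := An.
  exists d => // z' Oz' z'd.
  have [->|z'z] := eqVneq z' z; first by rewrite subrr linear0 normr0 mulr0.
  rewrite -ler_pdivrMr ?normr_gt0 ?subr_eq0// -lee_fin.
  apply: le_trans (ltW Ae); rewrite -AE; apply: ereal_sup_ubound; exists z' => //.
  by apply: dA => //; rewrite -ball_normE /= distrC.
apply/lee_addgt0Pr => e e0; rewrite add0e.
have [d d0 Hd] := H e e0.
apply: ereal_inf_le.
exists (ereal_sup [set (zs (z' - z) / `|z' - z|)%:E | z' in [set z' | z' != z /\ Om z' /\ `|z' - z| < d]]).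
  exists [set z' | z' != z /\ Om z' /\ `|z' - z| < d] => //.
  rewrite /within /dnbhs /=; apply: filterS (nbhsx_ballx z d d0) => z'.
  by rewrite -ball_normE /= distrC => zd z'z Oz'; split.
apply: ge_ereal_sup => _ [z' [z'z [Oz' z'd]] <-].
rewrite lee_fin ler_pdivrMr ?normr_gt0 ?subr_eq0//.
exact: Hd.
Qed.

Lemma dual_pair_scale {R : realType} {X Y : normedModType R} (k : R) (xs : dual X)
    (vs : dual Y) (z : X * Y) :
  dual_pair (k *: xs) (- (k *: vs)) z = k * dual_pair xs (- vs) z.
Proof.
rewrite /dual_pair /= /dual_pair_fun mulrDr; congr (_ + _).
by rewrite -[(- vs) _]/(- vs z.2) -[(- (k *: vs)) _]/(- (k * vs z.2)) mulrN.
Qed.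

Lemma frechet_normal_scale {R : realType} {X Y : normedModType R} (Om : set (X * Y))
    (z : X * Y) (k : R) (xs : dual X) (vs : dual Y) : 0 < k ->
  frechet_normal Om z (dual_pair xs (- vs)) ->
  frechet_normal Om z (dual_pair (k *: xs) (- (k *: vs))).
Proof.
move=> k0 /frechet_normalP nz; apply/frechet_normalP => e e0.
have [d d0 Hd] := nz (e / k) (divr_gt0 e0 k0); exists d => // z' Oz' z'd.
rewrite dual_pair_scale; have := Hd z' Oz' z'd.
by rewrite -(ler_pM2l k0) mulrA (mulrC e) mulVKf ?gt_eqF// => /le_trans; apply.
Qed.

Lemma clarke_normal_scale {R : realType} {X Y : normedModType R} (Om : set (X * Y))
    (z : X * Y) (k : R) (xs : dual X) (vs : dual Y) : 0 < k ->
  clarke_normal Om z (dual_pair xs (- vs)) ->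
  clarke_normal Om z (dual_pair (k *: xs) (- (k *: vs))).
Proof.
by move=> k0 nz u Tu; rewrite dual_pair_scale pmulr_rle0// nz.
Qed.

(* A witness at [z] is a finite certificate, by the Mazur--Orlicz theorem, that
   no Frechet normal at [z] with modulus [rad] and with the required bounds on
   its components exists. *)
Section witnesses.
Context {R : realType} {X Y : normedModType R}.
Context (Om : set (X * Y)) (ybar : Y) (A B ka : R).
Implicit Types (l : seq (R * (X * Y) * nat)) (z : X * Y) (rad : nat -> R).

(** An entry of [l] is a weight, a point of [Om], and an index n of the accuracy (n+1)^-1 at which
    the point is tested. *)
Definition wit_u l z := \sum_(e <- l) e.1.1 *: (e.1.2.1 - z.1).
Definition wit_v l z := \sum_(e <- l) e.1.1 *: (e.1.2.2 - z.2).
Definition wit_c l z :=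
  \sum_(e <- l) e.1.1 * (e.2.+1%:R^-1 * (`|e.1.2.1 - z.1| + `|e.1.2.2 - z.2|)).

(** The solvability expression of [functionals_exist]; a negative value refutes the system. *)
Definition wit_val t l z := A * `|wit_u l z| + `|wit_v l z + t *: (z.2 - ybar)| +
  B * `|wit_v l z| + wit_c l z - t * (ka * `|z.2 - ybar|).

Definition wit_adm rad M l z := forall e, e \in l ->
  [/\ 0 <= e.1.1, Om e.1.2, (e.2 < M)%N, `|e.1.2.1 - z.1| < rad e.2 &
      `|e.1.2.2 - z.2| < rad e.2].

Definition witness rad M t l z := [/\ 0 <= t, wit_adm rad M l z & wit_val t l z < 0].

Definition good_normal z (xs : dual X) (ys ws : dual Y) :=
  [/\ `|xs| <= A, `|ys| <= 1, `|ws| <= B, ka * `|z.2 - ybar| <= ys (z.2 - ybar) &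
      frechet_normal Om z (dual_pair xs (- (ys + ws)))].

(** If some modulus admits no witness, the system generated by all tests is solvable, and its
    one-entry tests say that the solution is a Frechet normal. *)
Lemma normal_or_witness z : 0 <= A -> 0 <= B ->
  (exists xs ys ws, good_normal z xs ys ws) \/
  (forall rad, (forall n, 0 < rad n) -> exists M t l, witness rad M t l z).
Proof.
move=> A0 B0.
have [|nw] := pselect (forall rad, (forall n, 0 < rad n) -> exists M t l, witness rad M t l z).
  by right.
left; move/existsNP : nw => [rad /not_implyP[rad0 nw]].
pose K u v c := exists l, [/\ exists M, wit_adm rad M l z, u = wit_u l z, v = wit_v l z & c = wit_c l z].
have K0 : K 0 0 0.
  exists [::]; rewrite /wit_u /wit_v /wit_c !big_nil; split => //.
  by exists 0%N => e; rewrite in_nil.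
have Kcone : convex_cone2 K.
  split => //.
  - move=> _ _ _ _ _ _ [l [[M lM] -> -> ->]] [l' [[M' lM'] -> -> ->]].
    exists (l ++ l'); rewrite /wit_u /wit_v /wit_c !big_cat; split => //.
    exists (maxn M M') => e; rewrite mem_cat => /orP[/lM|/lM'] [? ? eM ? ?]; split => //.
      by rewrite (leq_trans eM)// leq_maxl.
    by rewrite (leq_trans eM)// leq_maxr.
  - move=> s _ _ _ s0 [l [[M lM] -> -> ->]].
    exists [seq (s * e.1.1, e.1.2, e.2) | e <- l].
    rewrite /wit_u /wit_v /wit_c !big_map !scaler_sumr mulr_sumr; split.
    + exists M => _ /mapP[e /lM[? ? ? ? ?] ->]; split => //=; exact: mulr_ge0.
    + by apply: eq_bigr => e _; rewrite scalerA.
    + by apply: eq_bigr => e _; rewrite scalerA.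
    + by apply: eq_bigr => e _; rewrite mulrA.
have [|xs [ys [ws [xs1 ys1 ws1 ysb HK]]]] :=
    @functionals_exist R X Y K A B (ka * `|z.2 - ybar|) (z.2 - ybar) Kcone A0 B0.
  move=> u v c t [l [[M lM] -> -> ->]] t0; rewrite leNgt; apply/negP => val0.
  by apply: nw; exists M, t, l; split.
exists xs, ys, ws; split => //; apply/frechet_normalP => e e0.
have e2 : 0 < (e / 2)^-1 by rewrite invr_gt0 divr_gt0.
pose n := Num.truncn (e / 2)^-1.
have ne : n.+1%:R^-1 <= e / 2.
  rewrite invf_ple ?posrE ?divr_gt0// ltW//; exact: truncnS_gt.
exists (rad n) => // -[x y] Oxy; rewrite prod_normE gt_max /= => /andP[xd yd].
have := HK (x - z.1) (y - z.2) (n.+1%:R^-1 * (`|x - z.1| + `|y - z.2|)).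
rewrite /dual_pair_fun /= => H; apply: (le_trans (H _)).
  exists [:: (1, (x, y), n)]; rewrite /wit_u /wit_v /wit_c !big_seq1 /= !scale1r mul1r; split => //.
  by exists n.+1 => _ /[!inE] /eqP ->.
have m0 : 0 <= Num.max `|x - z.1| `|y - z.2| by rewrite le_max normr_ge0.
have H1 : `|x - z.1| + `|y - z.2| <= 2 * Num.max `|x - z.1| `|y - z.2|.
  by rewrite mulr2n mulrDl mul1r lerD// le_max lexx ?orbT.
apply: (@le_trans _ _ (e / 2 * (2 * Num.max `|x - z.1| `|y - z.2|))).
  by apply: ler_pM => //; rewrite ?invr_ge0// addr_ge0.
by rewrite mulrA divfK.
Qed.

(** With [l] fixed, only finitely many strict inequalities depend on [z], all continuously. *)
Lemma witness_open rad M t l z : witness rad M t l z ->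
  exists2 s : R, 0 < s & forall z', `|z' - z| < s -> witness rad M t l z'.
Proof.
move=> [t0 adm val0].
suff : \forall z' \near z, witness rad M t l z'.
  move=> /nbhs_ballP[s /= s0 H]; exists s => // z' zz'; apply: H.
  by rewrite -ball_normE /= distrC.
have c1 : z'.1 @[z' --> z] --> z.1 by exact: cvg_fst.
have c2 : z'.2 @[z' --> z] --> z.2 by exact: cvg_snd.
have n1 (q : X) : `|q - z'.1| @[z' --> z] --> `|q - z.1|.
  by apply: cvg_norm; apply: cvgB => //; exact: cvg_cst.
have n2 (q : Y) : `|q - z'.2| @[z' --> z] --> `|q - z.2|.
  by apply: cvg_norm; apply: cvgB => //; exact: cvg_cst.
have cu : wit_u l z' @[z' --> z] --> wit_u l z.
  rewrite /wit_u; elim: (l) => [|e l' IH].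
    by under eq_fun do rewrite big_nil; rewrite big_nil; exact: cvg_cst.
  under eq_fun do rewrite big_cons; rewrite big_cons; apply: cvgD => //.
  by apply: cvgZl_tmp; apply: cvgB => //; exact: cvg_cst.
have cv : wit_v l z' @[z' --> z] --> wit_v l z.
  rewrite /wit_v; elim: (l) => [|e l' IH].
    by under eq_fun do rewrite big_nil; rewrite big_nil; exact: cvg_cst.
  under eq_fun do rewrite big_cons; rewrite big_cons; apply: cvgD => //.
  by apply: cvgZl_tmp; apply: cvgB => //; exact: cvg_cst.
have cc : wit_c l z' @[z' --> z] --> wit_c l z.
  rewrite /wit_c; elim: (l) => [|e l' IH].
    by under eq_fun do rewrite big_nil; rewrite big_nil; exact: cvg_cst.
  under eq_fun do rewrite big_cons; rewrite big_cons; apply: cvgD => //.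
  by apply: cvgMl_tmp; apply: cvgMl_tmp; apply: cvgD; [exact: n1|exact: n2].
have cb : z'.2 - ybar @[z' --> z] --> z.2 - ybar by apply: cvgB => //; exact: cvg_cst.
have cval : wit_val t l z' @[z' --> z] --> wit_val t l z.
  rewrite /wit_val; apply: cvgB; last first.
    by apply: cvgMl_tmp; apply: cvgMl_tmp; apply: cvg_norm; exact: cb.
  apply: cvgD; last exact: cc.
  apply: cvgD; last by apply: cvgMl_tmp; apply: cvg_norm; exact: cv.
  apply: cvgD; first by apply: cvgMl_tmp; apply: cvg_norm; exact: cu.
  apply: cvg_norm; apply: cvgD; [exact: cv|apply: cvgZl_tmp; exact: cb].
have near_val : \forall z' \near z, wit_val t l z' < 0 by exact: cvgr_lt cval _ val0.
have near_adm : \forall z' \near z, wit_adm rad M l z'.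
  rewrite /wit_adm; elim: (l) adm => [|e l' IH] adm.
    by apply: (@filterE _ (nbhs z)) => z' e; rewrite in_nil.
  have [e1 e2 e3 e4 e5] := adm e (mem_head _ _).
  have m1 : \forall z' \near z, `|e.1.2.1 - z'.1| < rad e.2 by exact: cvgr_lt (n1 _) _ e4.
  have m2 : \forall z' \near z, `|e.1.2.2 - z'.2| < rad e.2 by exact: cvgr_lt (n2 _) _ e5.
  have m3 := IH (fun e' e'l => adm e' (mem_behead (e'l : e' \in behead (e :: l')))).
  apply: (@filterS3 _ (nbhs z) _ _ _ _ _ _ m1 m2 m3) => z' z1 z2 z3 e'.
  by rewrite inE => /predU1P[->|/z3].
by apply: (@filterS2 _ (nbhs z) _ _ _ _ _ near_val near_adm) => z' ? ?; split.
Qed.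

End witnesses.

(** * Separable subspaces closed under countably many operations *)

Lemma countable_closure (T : Type) (C : countType) (op : C -> T -> T -> T) (z0 : T) :
  exists (D : set T) (enum : seq (option C) -> T),
  [/\ D z0, forall c u v, D u -> D v -> D (op c u v) & D `<=` range enum].
Proof.
(* Words are evaluated by a stack machine: [None] pushes [z0], while [Some c]
   replaces the two topmost entries by their image under [op c]. *)
pose exec (s : seq T) (o : option C) := match o, s with
  | None, _ => z0 :: s | Some c, v :: u :: s' => op c u v :: s' | _, _ => s end.
pose run w s := foldl exec s w.
exists [set v | exists w, forall s, run w s = v :: s], (fun w => head z0 (run w [::])).
split.
- by exists [:: None].
- move=> c u v [wu Hu] [wv Hv]; exists (wu ++ wv ++ [:: Some c]) => s.
  by rewrite /run !foldl_cat -/(run wu s) Hu -/(run wv _) Hv.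
- by move=> v [w Hw]; exists w => //; rewrite Hw.
Qed.

Lemma closure_normP {R : realType} {T : normedModType R} (D : set T) (x : T) :
  closure D x <-> forall e : R, 0 < e -> exists2 d, D d & `|x - d| < e.
Proof.
split=> [clx e e0|H B /nbhs_ballP[e /= e0 eB]].
  have [d [Dd]] := clx _ (nbhsx_ballx x e e0).
  by rewrite -ball_normE => xd; exists d.
have [d Dd xd] := H e e0; exists d; split => //; apply: eB.
by rewrite -ball_normE.
Qed.

(** Real scalars are approximated by rational ones, so the closure is linear while [D] stays
    countable and dense in it. *)
Lemma closure_subspace {R : realType} {T : normedModType R} (C : countType)
    (enum : C -> T) (D : set T) : D 0 -> D `<=` range enum ->
  (forall u v, D u -> D v -> D (u + v)) -> (forall (r : rat) u, D u -> D (ratr r *: u)) ->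
  exists S : submodClosed T, (forall x, x \in S <-> closure D x) /\ separable (subsp S).
Proof.
move=> D0 Denum DD DZ.
pose P : {pred T} := fun x => `[< closure D x >].
have DaD (a : R) u v : closure D u -> closure D v -> closure D (a *: u + v).
  move=> /closure_normP Du /closure_normP Dv; apply/closure_normP => e e0.
  have e4 : 0 < e / 4 by rewrite divr_gt0.
  have u1 : 0 < `|u| + 1 by rewrite ltr_wpDl.
  have a0 : 0 < e / 4 / (`|u| + 1) by rewrite divr_gt0.
  have [|q] := @rat_in_itvoo R a (a + e / 4 / (`|u| + 1)); first by rewrite ltrDl.
  rewrite in_itv /= => /andP[aq qa].
  have q1 : 0 < `|ratr q : R| + 1 by rewrite ltr_wpDl.
  have e4q : 0 < e / 4 / (`|ratr q : R| + 1) by rewrite divr_gt0.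
  have [d Dd ud] := Du _ e4q; have [d' Dd' vd'] := Dv _ e4.
  exists (ratr q *: d + d'); first exact: DD (DZ q d Dd) Dd'.
  have -> : a *: u + v - (ratr q *: d + d') =
      (a - ratr q) *: u + ratr q *: (u - d) + (v - d').
    by rewrite scalerBl scalerBr subrKA opprD addrACA addrA.
  rewrite (le_lt_trans (ler_normD _ _))//.
  have H1 : `|(a - ratr q) *: u| <= e / 4.
    rewrite normrZ distrC gtr0_norm ?subr_gt0//.
    apply: (@le_trans _ _ (e / 4 / (`|u| + 1) * (`|u| + 1))); last by rewrite divfK// gt_eqF.
    by apply: ler_pM => //; rewrite ?subr_ge0 ?lerDl// ?lerBlDl ltW.
  have H2 : `|ratr q *: (u - d)| <= e / 4.
    rewrite normrZ mulrC.
    apply: (@le_trans _ _ (e / 4 / (`|ratr q : R| + 1) * (`|ratr q : R| + 1))); last first.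
      by rewrite divfK// gt_eqF.
    by apply: ler_pM => //; rewrite ?lerDl// ltW.
  have := ler_normD ((a - ratr q) *: u) (ratr q *: (u - d)).
  by move: H1 H2 vd' e0; lra.
have hP : submod_closed P.
  split; first by apply/asboolP; exact: subset_closure.
  by move=> a u v /asboolP Pu /asboolP Pv; apply/asboolP; exact: DaD.
pose S : submodClosed T := HB.pack P (GRing.isSubmodClosed.Build R T P hP).
have SP x : x \in S <-> closure D x by split=> [/asboolP|Dx]//; apply/asboolP.
exists S; split => //.
have /choice[code codeE] (x : T) : exists c : C, D x -> enum c = x.
  have [/Denum[c _ <-]|nD] := pselect (D x); first by exists c.
  by have [c _ _] := Denum _ D0; exists c.
exists [set u : subsp S | D (subsp_val u)].
  apply/countable_injP; exists (fun u => pickle (code (subsp_val u))) => u v.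
  rewrite !inE /= => Du Dv /(pcan_inj pickleK) cuv; apply: val_inj => /=.
  by rewrite -(codeE _ Du) cuv codeE.
move=> O [u Ou] oO; have /nbhs_ballP[e /= e0 eO] := open_nbhs_nbhs (conj oO Ou).
have /SP/closure_normP/(_ _ e0)[d Dd ud] := subsp_valP u.
have dS : d \in S by apply/SP; exact: subset_closure.
exists (Subsp dS); split => //; apply: eO.
by rewrite -ball_normE.
Qed.

Lemma inv_nat_lt {R : realType} (r : R) : 0 < r -> exists n, n.+1%:R^-1 < r.
Proof.
move=> r0; exists (Num.truncn r^-1).
by rewrite invf_plt ?posrE//; exact: truncnS_gt.
Qed.

Section separable_reduction.
Context {R : realType} {X Y : completeNormedModType R}.

(* If there were no such normal near [(xh, yh)], every point near it would have
   a witness for every modulus.  Closing [(xh, yh)] and [ybar] under rational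
   linear combinations and under a choice of witnesses gives separable subspaces
   in which the smooth fuzzy rule applies, while witnesses there contradict it. *)
Lemma frechet_normal_exists (Om : set (X * Y)) (xh : X) (yh ybar : Y) (a w eps rho : R) :
  closed Om -> asplund X -> asplund Y ->
  Om (xh, yh) -> yh <> ybar -> 0 <= a -> 0 <= w -> 0 < eps -> 0 < rho ->
  (forall x y, Om (x, y) -> `|yh - ybar| <= `|y - ybar| + a * `|x - xh| + w * `|y - yh|) ->
  exists z xs ys ws, [/\ Om z, `|z.1 - xh| < rho, `|z.2 - yh| < rho &
    good_normal Om ybar (a + eps) (w + eps) (1 - eps) z xs ys ws].
Proof.
move=> cOm aX aY Oh yhb a0 w0 eps0 rho0 Omin; apply: contrapT => nex.
have A0 : 0 <= a + eps by rewrite addr_ge0// ltW.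
have B0 : 0 <= w + eps by rewrite addr_ge0// ltW.
pose wit := witness Om ybar (a + eps) (w + eps) (1 - eps).
have witex z rad : Om z -> `|z.1 - xh| < rho -> `|z.2 - yh| < rho ->
    (forall n, 0 < rad n) -> exists M t l, wit rad M t l z.
  move=> Oz zx zy rad0.
  have [[xs [ys [ws gn]]]|] := normal_or_witness Om ybar (1 - eps) z A0 B0; last exact.
  by case: nex; exists z, xs, ys, ws.
(* A witness reads finitely many radii, so moduli are coded by finite lists and form a countable
   family; beyond the list the radius is 1. *)
pose rad (ms : seq nat) n : R := (nth 0%N ms n).+1%:R^-1.
(* A witness valid on a whole ball, so that one chosen at a point of [D] also serves at nearby limit
   points. *)
pose uwit (c : seq nat * nat) z : set (R * seq (R * (X * Y) * nat)) :=
  [set p | forall z', `|z' - z| < c.2.+1%:R^-1 -> wit (rad c.1) (size c.1) p.1 p.2 z'].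
pose W c z := xget (0, [::]) (uwit c z).
(* One countable family of binary operations; unary ones ignore [v], and an index outside the
   witness list returns [u]. *)
pose op (c : nat * rat * (seq nat * nat * nat)) (u v : X * Y) : X * Y :=
  match c.1.1 with
  | 0%N => u + v
  | 1%N => ratr c.1.2 *: u
  | 2%N => (u.1, 0)
  | 3%N => (0, u.2)
  | 4%N => (0, ybar)
  | _ => (nth (0, u, 0%N) (W c.2.1 u).2 c.2.2).1.2
  end.
have [D [enum [Dh Dop Denum]]] := countable_closure op (xh, yh).
have c0 : seq nat * nat * nat := ([::], 0%N, 0%N).
have DD u v : D u -> D v -> D (u + v) := Dop (0%N, 0 : rat, c0) u v.
have DZ (r : rat) u : D u -> D (ratr r *: u).
  by move=> Du; exact: (Dop (1%N, r, c0) u u).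
have D1 u : D u -> D (u.1, 0) by move=> Du; exact: (Dop (2%N, 0 : rat, c0) u u).
have D2 u : D u -> D (0, u.2) by move=> Du; exact: (Dop (3%N, 0 : rat, c0) u u).
have Db : D (0, ybar) by exact: (Dop (4%N, 0 : rat, c0) _ _ Dh Dh).
have DW c u e : D u -> e \in (W c u).2 -> D e.1.2.
  move=> Du eW; have := Dop (5%N, 0 : rat, (c, index e (W c u).2)) _ _ Du Du.
  by rewrite /op/= nth_index.
have [||||SX [SXP sSX]] := @closure_subspace R X _ (fun c => (enum c).1) (fst @` D).
- by exists (0, yh) => //; exact: (D2 _ Dh).
- by move=> _ [u /Denum[c _ <-] <-]; exists c.
- by move=> _ _ [u Du <-] [v Dv <-]; exists (u + v) => //; exact: DD.
- by move=> r _ [u Du <-]; exists (ratr r *: u) => //; exact: DZ.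
have [||||SY [SYP sSY]] := @closure_subspace R Y _ (fun c => (enum c).2) (snd @` D).
- by exists (xh, 0) => //; exact: (D1 _ Dh).
- by move=> _ [u /Denum[c _ <-] <-]; exists c.
- by move=> _ _ [u Du <-] [v Dv <-]; exists (u + v) => //; exact: DD.
- by move=> r _ [u Du <-]; exists (ratr r *: u) => //; exact: DZ.
have DSX u : D u -> u.1 \in SX by move=> Du; apply/SXP; apply: subset_closure; exists u.
have DSY u : D u -> u.2 \in SY by move=> Du; apply/SYP; apply: subset_closure; exists u.
have rangeX : range (@subsp_val R X SX) = closure (fst @` D).
  apply/seteqP; split=> [_ [u _ <-]|x /SXP xS]; first by apply/SXP; exact: subsp_valP.
  by exists (Subsp xS).
have rangeY : range (@subsp_val R Y SY) = closure (snd @` D).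
  apply/seteqP; split=> [_ [u _ <-]|x /SYP xS]; first by apply/SYP; exact: subsp_valP.
  by exists (Subsp xS).
have cS := @complete_set_isometry R (subsp SX) (subsp SY) X Y
  (@subsp_val R X SX) (@subsp_val R Y SY) Om (fun _ _ => erefl) (fun _ _ => erefl).
rewrite rangeX rangeY in cS.
have {}cS := cS (@closed_closure _ _) (@closed_closure _ _) cOm.
pose xh' := Subsp (DSX _ Dh); pose yh' := Subsp (DSY _ Dh); pose yb' := Subsp (DSY _ Db).
have [||x1 [y1 [del [Oz1 [x1h y1h] del0 normals]]]] :=
  @smooth_fuzzy_rule R (subsp SX) (subsp SY) _ xh' yh' yb' a w eps rho cS
    (aX SX sSX) (aY SY sSY) Oh _ a0 w0 eps0 rho0.
- by move=> /(congr1 (@subsp_val _ _ _)).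
- by move=> x y; exact: Omin.
pose z1 : X * Y := (subsp_val x1, subsp_val y1).
have /choice[m mP] n : exists m, m.+1%:R^-1 < del n by exact: inv_nat_lt.
(* The order of choices matters: the radii [del] fix the modulus, the witness then fixes [M], and
   only afterwards are functionals taken for this [M]. *)
have [|M [t [l wl]]] := witex z1 (fun n => (m n).+1%:R^-1) Oz1 x1h y1h.
  by move=> n; rewrite invr_gt0.
pose ms := mkseq m M.
have {}wl : wit (rad ms) (size ms) t l z1.
  case: wl => t0 adm val0; split => // e el.
  have [? ? eM ? ?] := adm e el.
  by rewrite /rad /ms size_mkseq nth_mkseq.
have [s s0 ws] := witness_open wl.
have [j js] : exists j, j.+1%:R^-1 < s / 2 by apply: inv_nat_lt; rewrite divr_gt0.
have j0 : 0 < j.+1%:R^-1 :> R by rewrite invr_gt0.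
have [d Dd z1d] : exists2 d, D d & `|z1 - d| < j.+1%:R^-1.
  have /SXP/closure_normP/(_ _ j0)[_ [u Du <-] xu] := subsp_valP x1.
  have /SYP/closure_normP/(_ _ j0)[_ [v Dv <-] yv] := subsp_valP y1.
  exists ((u.1, 0) + (0, v.2)); first exact: DD (D1 _ Du) (D2 _ Dv).
  by rewrite prod_normE gt_max /= addr0 add0r xu yv.
(* The points of [l] may lie outside the subspaces, but [l] shows that a uniform witness at [d]
   exists; the chosen one has all its points in [D]. *)
have : uwit (ms, j) d (W (ms, j) d).
  apply: xgetPex; exists (t, l) => z' z'd; apply: ws.
  rewrite -(subrKA d) (le_lt_trans (ler_normD _ _))// (distrC d).
  move: z'd z1d js => /=; move: (j.+1%:R^-1) => q.
  by rewrite (distrC z1); clear; lra.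
move=> /(_ z1 z1d) /=; move: (DW (ms, j) d ^~ Dd); move: (W (ms, j) d) => [t' l'] /= Dl' [t'0 adm].
rewrite ltNge => /negP; apply.
have [xs [ys [vs [xs1 ys1 vs1 ysb est]]]] := normals M.
(* Each entry is a test inequality for the normal in the subspace; their weighted sum contradicts
   the negative witness value. *)
have [U [V [UE VE UV]]] : exists (U : subsp SX) (V : subsp SY),
    [/\ subsp_val U = wit_u l' z1, subsp_val V = wit_v l' z1 &
        xs U - (ys V + vs V) <= wit_c l' z1].
  have : {subset l' <= l'} by [].
  rewrite /wit_u /wit_v /wit_c; elim: {1 3 4 5}l' => [|e l1 IH] sub.
    by exists 0, 0; rewrite !big_nil !linear0 addr0 subr0.
  have [U [V [UE VE UV]]] := IH (fun e' e'l => sub e' (mem_behead (e'l : e' \in behead (e :: l1)))).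
  have el : e \in l' by apply: sub; exact: mem_head.
  have [e1 e2 e3 e4 e5] := adm e el.
  have De := Dl' e el.
  pose u' := Subsp (DSX _ De); pose v' := Subsp (DSY _ De).
  exists (e.1.1 *: (u' - x1) + U), (e.1.1 *: (v' - y1) + V).
  rewrite !big_cons -UE -VE; split => //.
  have eM : (e.2 < M)%N by move: e3; rewrite /ms size_mkseq.
  have radE : rad ms e.2 = (m e.2).+1%:R^-1 by rewrite /rad /ms nth_mkseq.
  have Oe : Om (subsp_val u', subsp_val v') by rewrite /=; case: (e.1.2) e2.
  have ud : `|u' - x1| < del e.2 by apply: lt_trans (mP e.2); rewrite -radE; exact: e4.
  have vd : `|v' - y1| < del e.2 by apply: lt_trans (mP e.2); rewrite -radE; exact: e5.
  have H := est e.2 u' v' (ltnW eM) Oe ud vd.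
  have lin (Z : normedModType R) (f : dual Z) (c : R) (p q : Z) : f (c *: p + q) = c * f p + f q.
    by rewrite linearP.
  rewrite !lin.
  have : e.1.1 * (xs (u' - x1) - (ys (v' - y1) + vs (v' - y1))) <=
      e.1.1 * (e.2.+1%:R^-1 * (`|u' - x1| + `|v' - y1|)).
    exact: ler_wpM2l.
  move: UV.
  rewrite -[`|u' - x1|]/(`|e.1.2.1 - z1.1|) -[`|v' - y1|]/(`|e.1.2.2 - z1.2|).
  move: (xs _) (xs _) (ys _) (ys _) (vs _) (vs _) (\sum_(_ <- _) _) => p1 p2 p3 p4 p5 p6 p7.
  by move: (_^-1 * _) => p8; clear; lra.
rewrite /wit_val -UE -VE.
have U1 : `|xs U| <= (a + eps) * `|U| by rewrite (le_trans (dual_norm_le _ _))// ler_wpM2r.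
have V1 : `|vs V| <= (w + eps) * `|V| by rewrite (le_trans (dual_norm_le _ _))// ler_wpM2r.
have V2 : ys (V + t' *: (y1 - yb')) <= `|V + t' *: (y1 - yb')|.
  by rewrite (le_trans (dual_apply_le _ _))// ler_piMl.
have V3 : t' * ((1 - eps) * `|y1 - yb'|) <= t' * ys (y1 - yb') by rewrite ler_wpM2l.
have E2 : ys (V + t' *: (y1 - yb')) = ys V + t' * ys (y1 - yb') by rewrite linearD linearZ.
rewrite {}E2 in V2.
move: U1 V1; rewrite !ler_norml => /andP[U1 _] /andP[_ V1].
rewrite -[`|subsp_val V + _|]/(`|V + t' *: (y1 - yb')|) -[`|subsp_val U|]/(`|U|).
rewrite -[`|subsp_val V|]/(`|V|) -[`|z1.2 - ybar|]/(`|y1 - yb'|).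
move: UV U1 V1 V2 V3.
move: (xs U) (ys V) (vs V) (ys _) (wit_c _ _) `|V + _| `|U| `|V| `|y1 - yb'|.
by clear; move=> p1 p2 p3 p4 p5 p6 p7 p8 p9; lra.
Qed.

End separable_reduction.

(** * From normals to subregularity *)

Lemma edist_inf_ltP {R : realType} {Z : normedModType R} (A : set Z) (z : Z) (c : \bar R) :
  (edist_inf A z < c)%E <-> exists2 u, A u & (`|z - u|%:E < c)%E.
Proof.
split=> [/ereal_inf_lt[_ [u Au <-]]|[u Au uc]]; first by rewrite edistE; exists u.
by apply: le_lt_trans uc; rewrite -edistE; apply: ereal_inf_lbound; exists u.
Qed.

(** |ys| = 1 gives |vs| > 1 - eta, so normalising enlarges [xs] by a factor below 1 / (1 - eta). *)
Lemma edist_inf0_lt {R : realType} {X Y : normedModType R} (A : set (dual X))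
    (xs : dual X) (ys vs : dual Y) (alpha eta : R) :
  0 < eta < 1 -> 0 < alpha -> `|xs| < alpha -> `|ys| = 1 -> `|vs - ys| < eta ->
  (0 < `|vs|^-1) /\
  (A (`|vs|^-1 *: xs) -> ~ ((alpha / (1 - eta))%:E <= edist_inf A 0%R)%E).
Proof.
move=> /andP[eta0 eta1] al0 xsa ys1 vse.
have vs1 : 1 - eta < `|vs|.
  have := ler_normD vs (ys - vs); rewrite addrC subrK ys1 distrC.
  by move: vse; lra.
have e1 : 0 < 1 - eta by lra.
have vs0 : 0 < `|vs| := lt_trans e1 vs1.
split=> [|Axs]; first by rewrite invr_gt0.
apply/negP; rewrite -ltNge; apply/edist_inf_ltP; exists (`|vs|^-1 *: xs) => //.
rewrite sub0r normrN normrZ ger0_norm ?invr_ge0// lte_fin mulrC.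
rewrite ltr_pdivrMr//; apply: (lt_trans xsa).
rewrite mulrAC ltr_pdivlMr// ltr_pM2l//.
Qed.

Theorem corollary4p9 (R : realType) (P : Type) (X Y : completeNormedModType R)
    (F : P -> X -> set Y) (xbar : X) (ybar : Y)
    (alpha : R) (delta mu : \bar R)
    (P_nonempty : inhabited P)
    (gph_closed : forall p, closed (gph (F p)))
    (alpha_gt0 : 0 < alpha) (delta_gt0 : (0 < delta)%E) (mu_gt0 : (0 < mu)%E) :
  (exists2 eta : R, 0 < eta < 1 &
    forall p : P,
      (forall (x : X) (y : Y),
         eball xbar (delta + mu)%E x -> ~ preimg (F p) ybar x ->
         F p x y -> eball ybar (alpha%:E * mu)%E y ->
         forall ys : dual Y, `|ys| = 1 -> ys (y - ybar) = `|y - ybar| ->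
         forall vs : dual Y, eball ys eta%:E vs ->
         ((alpha / (1 - eta))%:E <=
          edist_inf (clarke_coderivative (F p) x y (`|vs|^-1 *: vs)) 0%R)%E)
      \/
      [/\ asplund X, asplund Y &
       exists2 tau : R, 0 < tau < 1 &
       forall (x : X) (y : Y),
         eball xbar (delta + mu)%E x -> ~ preimg (F p) ybar x ->
         F p x y -> eball ybar (alpha%:E * mu)%E y ->
         forall ys : dual Y, `|ys| = 1 -> tau * `|y - ybar| < ys (y - ybar) ->
         forall vs : dual Y, eball ys eta%:E vs ->
         ((alpha / (1 - eta))%:E <=
          edist_inf (frechet_coderivative (F p) x y (`|vs|^-1 *: vs)) 0%R)%E]) ->
  subregular F alpha xbar ybar delta mu.
Proof.
move=> [eta eta01 H] p x0 x0d; have /andP[eta0 eta1] := eta01.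
move=> dmu; rewrite leNgt; apply/negP => dalpha.
set D := edist_inf (preimg (F p) ybar) x0 in dalpha.
have [y0 Fy0 y0m] : exists2 y0, F p x0 y0 & (`|ybar - y0|%:E < alpha%:E * Order.min mu D)%E.
  apply/edist_inf_ltP; rewrite mine_pMr ?lee_fin ?(ltW alpha_gt0)//.
  by rewrite lt_min dmu.
(* A finite radius, even if the minimum is infinite: r <= mu keeps points in the ball of radius
   delta + mu, and r <= D keeps them off the solution set. *)
have [r [r0 rm y0r]] : exists r : R, [/\ 0 < r, (r%:E <= Order.min mu D)%E & `|y0 - ybar| < alpha * r].
  move: y0m; rewrite distrC; case: (Order.min mu D) => [m||].
  - rewrite -EFinM lte_fin => y0m; exists m; split => //.
    by rewrite -(pmulr_rgt0 _ alpha_gt0) (le_lt_trans _ y0m).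
  - move=> _; exists ((`|y0 - ybar| + 1) / alpha); rewrite leey divr_gt0 ?ltr_wpDl//; split => //.
    by rewrite mulrC divfK ?gt_eqF// ltrDl.
  - by rewrite mulrNy gtr0_sg// mul1e.
move: rm; rewrite le_min => /andP[rmu rD].
have inball x : `|x - x0| < r -> eball xbar (delta + mu)%E x.
  move=> xr; rewrite /eball /=.
  apply: (@le_lt_trans _ _ (`|x0 - xbar| + `|x - x0|)%:E).
    by rewrite lee_fin -(subrKA x0) addrC ler_normD.
  by rewrite EFinD; apply: lte_leD => //; apply: le_trans rmu; rewrite lee_fin ltW.
have notpre x : `|x - x0| < r -> ~ preimg (F p) ybar x.
  move=> xr Fx; have : (D < r%:E)%E.
    by apply/edist_inf_ltP; exists x => //; rewrite distrC lte_fin.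
  by rewrite ltNge rD.
have inyball y : `|y - ybar| < alpha * r -> eball ybar (alpha%:E * mu)%E y.
  move=> yr; rewrite /eball /=; apply: (@lt_le_trans _ _ (alpha * r)%:E).
    by rewrite lte_fin.
  by rewrite EFinM lee_pmul2l.
have eta2 : 0 < eta / 2 by rewrite divr_gt0.
have [xh [yh [a [Oh [xhr yhr] /andP[a0 aal] Emin]]]] :=
  @ekeland_point R X Y (gph (F p)) x0 y0 ybar alpha r (eta / 2)
    (gph_closed p) Fy0 alpha_gt0 r0 eta2 y0r.
have neq x y : `|x - x0| < r -> F p x y -> 0 < `|y - ybar|.
  move=> xr Fxy; rewrite normr_gt0 subr_eq0; apply/eqP => yE.
  by apply: (notpre x xr); rewrite /preimg /= -yE.
have b0 := neq _ _ xhr Oh.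
case: (H p) => [{}H|[aX aY [tau /andP[tau0 tau1] {}H]]].
  have [xs [ys [ws [xs1 ys1 ws1 ysb nor]]]] := clarke_normal_exists Oh a0 (ltW eta2) Emin.
  have ys1' : `|ys| = 1.
    apply/le_anti; rewrite ys1 /= -(ler_pM2r b0) mul1r -{1}ysb.
    exact: dual_apply_le.
  have vse : `|(ys + ws) - ys| < eta by rewrite addrC addKr (le_lt_trans ws1)//; lra.
  have [vs0 contra] := edist_inf0_lt (clarke_coderivative (F p) xh yh (`|ys + ws|^-1 *: (ys + ws)))
    eta01 alpha_gt0 (le_lt_trans xs1 aal) ys1' vse.
  apply: contra.
    exact: clarke_normal_scale.
  apply: (H xh yh (inball _ xhr) (notpre _ xhr) Oh (inyball _ yhr) ys ys1' ysb).
  by rewrite /eball /= lte_fin.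
(* The three bounds give a + eps < alpha, a total deviation eps + (eta/2 + eps) < eta of [ys + ws]
   from the normalised [ys], and 1 - eps > tau. *)
pose eps := Num.min ((alpha - a) / 2) (Num.min (eta / 8) ((1 - tau) / 2)).
have eps0 : 0 < eps by rewrite !lt_min !divr_gt0 ?subr_gt0.
have epsa : eps <= (alpha - a) / 2 by rewrite ge_min lexx.
have epse : eps <= eta / 8 by rewrite !ge_min lexx orbT.
have epst : eps <= (1 - tau) / 2 by rewrite !ge_min lexx !orbT.
pose rho := Num.min (r - `|xh - x0|) (alpha * r - `|yh - ybar|).
have rho0 : 0 < rho by rewrite lt_min !subr_gt0 xhr.
have yhb : yh <> ybar by move=> yhE; move: b0; rewrite yhE subrr normr0 ltxx.
have [[x y] [xs [ys [ws [Oxy /= xxh yyh [xs1 ys1 ws1 ysb nor]]]]]] :=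
  frechet_normal_exists (gph_closed p) aX aY Oh yhb a0 (ltW eta2) eps0 rho0 Emin.
have xr : `|x - x0| < r.
  move: xxh; rewrite lt_min => /andP[+ _]; have := ler_normD (x - xh) (xh - x0).
  by rewrite subrKA; lra.
have yr : `|y - ybar| < alpha * r.
  move: yyh; rewrite lt_min => /andP[_ +]; have := ler_normD (y - yh) (yh - ybar).
  by rewrite subrKA; lra.
have c0 := neq _ _ xr Oxy; rewrite /= in ysb.
have ysge : 1 - eps <= `|ys|.
  by rewrite -(ler_pM2r c0) (le_trans ysb)// dual_apply_le.
have eps1 : 0 < 1 - eps by move: epse eta1; clear; lra.
have aeps : a + eps < alpha by move: epsa aal; clear; lra.
have taueps : tau < 1 - eps by move: epst tau1; clear; lra.
have ys0 : 0 < `|ys| by move: ysge eps1; clear; lra.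
(* The fuzzy rule only gives 1 - eps <= |ys| <= 1, so a unit functional is restored at cost
   [eps]. *)
pose yn := `|ys|^-1 *: ys.
have yn1 : `|yn| = 1 by rewrite normrZ ger0_norm ?invr_ge0// mulVf// gt_eqF.
have ysn : `|ys - yn| <= eps.
  have -> : ys - yn = (`|ys| - 1) *: yn.
    by rewrite scalerBl scale1r /yn scalerA mulfV ?scale1r// gt_eqF.
  by rewrite normrZ yn1 mulr1 ler0_norm ?subr_le0//; move: ysge; clear; lra.
have vse : `|(ys + ws) - yn| < eta.
  have -> : ys + ws - yn = (ys - yn) + ws by rewrite addrAC.
  by rewrite (le_lt_trans (ler_normD _ _))//; move: ysn ws1 epse eta0; clear; lra.
have yntau : tau * `|y - ybar| < yn (y - ybar).
  have -> : yn (y - ybar) = `|ys|^-1 * ys (y - ybar) by [].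
  have yspos : 0 <= ys (y - ybar) by apply: le_trans ysb; rewrite mulr_ge0// ltW.
  apply: (@lt_le_trans _ _ ((1 - eps) * `|y - ybar|)); first by rewrite ltr_pM2r.
  by rewrite (le_trans ysb)// ler_peMl// invf_ge1.
have [vs0 contra] := edist_inf0_lt (frechet_coderivative (F p) x y (`|ys + ws|^-1 *: (ys + ws)))
  eta01 alpha_gt0 (le_lt_trans xs1 aeps) yn1 vse.
apply: contra; first exact: frechet_normal_scale.
apply: (H x y (inball _ xr) (notpre _ xr) Oxy (inyball _ yr) yn yn1 yntau).
by rewrite /eball /= lte_fin.
Qed.
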